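(* Let $E$ be a Hilbert $C^*$-module over a $C^*$-algebra $\mathcal{A}$ and let $L\subset E$ be a nonempty closed convex subset. For each vector $x_0\in E\setminus L$ there exists a state $\omega$ on $\mathcal{A}$ such that $\iota_\omega(x_0)$ is not in the closure of $\iota_\omega(L)$ in $E^\omega$. In particular, if $L\neq E$, there exists a state $\omega$ on $\mathcal{A}$ such that $\iota_\omega(L)$ is not dense in $E^\omega$ and thus, when $L$ is an $\mathcal{A}$-submodule of $E$, $\iota_\omega(L)^\perp\neq\{0\}$.
   Context: $C^*$-algebras are not assumed unital. A Hilbert $C^*$-module $E$ over $\mathcal{A}$ is a right $\mathcal{A}$-module with an $\mathcal{A}$-valued inner product $\langle\cdot,\cdot\rangle$ (conjugate linear in the first, linear in the second variable), complete in the norm $\|x\|=\|\langle x,x\rangle\|^{1/2}$. For a state $\omega$ on $\mathcal{A}$, put $\langle x,y\rangle_\omega=\omega(\langle x,y\rangle)$ on $E$ and $\mathcal{N}_\omega=\{x\in E:\langle x,x\rangle_\omega=0\}$; $E^\omega$ is the Hilbert space completion of $E/\mathcal{N}_\omega$ with respect to the inner product induced by $\langle\cdot,\cdot\rangle_\omega$, and $\iota_\omega:E\to E^\omega$ is the natural map. The orthogonal complement $\perp$ is taken in the Hilbert space $E^\omega$. *)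

(* Defs.v *)
From HB Require Import structures.
From mathcomp Require Import all_boot all_order all_algebra.
From mathcomp Require Import generic_quotient ring_quotient.
From mathcomp Require Import complex ring.
From mathcomp Require Import all_classical all_reals all_analysis.

Set Implicit Arguments.
Unset Strict Implicit.
Unset Printing Implicit Defensive.

Import Order.TTheory GRing.Theory Num.Theory.
Import numFieldNormedType.Exports.

Local Open Scope classical_set_scope.
Local Open Scope quotient_scope.
Local Open Scope ring_scope.

(* The algebra structure is spelled out because MathComp rings have a unit.
   Norms of normed modules over R[i] take their values in R[i]. *)
HB.mixin Record CompleteNormedModule_isCStarAlgebra (R : realType) A
    of CompleteNormedModule R[i] A := {
  cmul : A -> A -> A ;
  cstar : A -> A ;
  cmulA : associative cmul ;
  cmulDl : left_distributive cmul +%R ;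
  cmulDr : right_distributive cmul +%R ;
  cmulZl : forall (k : R[i]) a b, cmul (k *: a) b = k *: cmul a b ;
  cmulZr : forall (k : R[i]) a b, cmul a (k *: b) = k *: cmul a b ;
  cstarK : involutive cstar ;
  cstarD : {morph cstar : a b / a + b} ;
  cstarZ : forall (k : R[i]) a, cstar (k *: a) = k^* *: cstar a ;
  cstarM : forall a b, cstar (cmul a b) = cmul (cstar b) (cstar a) ;
  cnormM : forall a b, `|cmul a b| <= `|a| * `|b| ;
  cnorm_star : forall a, `|cmul (cstar a) a| = `|a| ^+ 2
}.

#[short(type="cstarAlgType")]
HB.structure Definition CStarAlgebra (R : realType) :=
  {A of CompleteNormedModule R[i] A
      & CompleteNormedModule_isCStarAlgebra R A}.

(* Also correct without a unit: the positive elements of a C*-algebra are those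
   of the form b^* b. *)
Definition cpositive (R : realType) (A : cstarAlgType R) (a : A) : Prop :=
  exists b : A, a = cmul (cstar b) b.

HB.mixin Record CompleteNormedModule_isHilbertCModule (R : realType)
    (A : cstarAlgType R) E of CompleteNormedModule R[i] E := {
  ract : E -> A -> E ;
  inner : E -> E -> A ;
  ractDl : forall x y a, ract (x + y) a = ract x a + ract y a ;
  ractDr : forall x a b, ract x (a + b) = ract x a + ract x b ;
  ractZl : forall (k : R[i]) x a, ract (k *: x) a = k *: ract x a ;
  ractZr : forall (k : R[i]) x a, ract x (k *: a) = k *: ract x a ;
  ractM : forall x a b, ract x (cmul a b) = ract (ract x a) b ;
  innerDr : forall x y z, inner x (y + z) = inner x y + inner x z ;
  innerZr : forall (k : R[i]) x y, inner x (k *: y) = k *: inner x y ;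
  inner_star : forall x y, cstar (inner x y) = inner y x ;
  inner_act : forall x y a, inner x (ract y a) = cmul (inner x y) a ;
  inner_ge0 : forall x, cpositive (inner x x) ;
  norm_inner : forall x, `|x| = sqrtC `|inner x x|
}.

#[short(type="hilbertCModType")]
HB.structure Definition HilbertCModule (R : realType) (A : cstarAlgType R) :=
  {E of CompleteNormedModule R[i] E
      & CompleteNormedModule_isHilbertCModule R A E}.

Definition submodule (R : realType) (A : cstarAlgType R)
    (E : hilbertCModType A) (L : set E) : Prop :=
  [/\ L 0,
      forall x y, L x -> L y -> L (x + y),
      forall (k : R[i]) x, L x -> L (k *: x)
    & forall x (a : A), L x -> L (ract x a)].

(* Since [sup] of a set without a supremum is 0, [state_norm] also says that
   the functional is bounded. *)
Record state (R : realType) (A : cstarAlgType R) := State {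
  state_fun :> {scalar A} ;
  state_ge0 : forall a : A, cpositive a -> 0 <= state_fun a ;
  state_norm :
    sup [set complex.Re `|state_fun a| | a in [set a : A | `|a| <= 1]] = 1
}.

(* Complex inner products are conjugate linear in the first variable, as for
   Hilbert modules. *)
HB.mixin Record NormedModule_isPreHilbert (R : realType) V
    of NormedModule R[i] V := {
  dot : V -> V -> R[i] ;
  dotDr : forall x y z, dot x (y + z) = dot x y + dot x z ;
  dotZr : forall (k : R[i]) x y, dot x (k *: y) = k * dot x y ;
  dotC : forall x y, (dot x y)^* = dot y x ;
  dot_ge0 : forall x, 0 <= dot x x ;
  norm_dot : forall x, `|x| = sqrtC (dot x x)
}.

#[short(type="preHilbertType")]
HB.structure Definition PreHilbert (R : realType) :=
  {V of NormedModule R[i] V & NormedModule_isPreHilbert R V}.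

#[short(type="hilbertType")]
HB.structure Definition Hilbert (R : realType) :=
  {V of PreHilbert R V & Complete V}.

Definition orthocompl (R : realType) (H : preHilbertType R) (S : set H) :
    set H :=
  [set y | forall x, S x -> dot x y = 0].

Record semiInner (R : realType) (V : lmodType R[i]) := SemiInner {
  sform :> V -> V -> R[i] ;
  sformDr : forall x y z, sform x (y + z) = sform x y + sform x z ;
  sformZr : forall (k : R[i]) x y, sform x (k *: y) = k * sform x y ;
  sformC : forall x y, (sform x y)^* = sform y x ;
  sform_ge0 : forall x, 0 <= sform x x
}.

Section SemiInnerTheory.
Variables (R : realType) (V : lmodType R[i]) (s : semiInner V).
Implicit Types (x y z : V) (k : R[i]).

Lemma sformDl x y z : s (x + y) z = s x z + s y z.
Proof. by rewrite -sformC sformDr rmorphD/= !sformC. Qed.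

Lemma sformZl k x y : s (k *: x) y = k^* * s x y.
Proof. by rewrite -sformC sformZr rmorphM/= sformC. Qed.

Lemma sformNr x y : s x (- y) = - s x y.
Proof. by rewrite -scaleN1r sformZr mulN1r. Qed.

Lemma sformNl x y : s (- x) y = - s x y.
Proof. by rewrite -sformC sformNr rmorphN/= sformC. Qed.

Lemma sform_CS x y : `|s x y| ^+ 2 <= s x x * s y y.
Proof.
have sx := sform_ge0 s x; have sy := sform_ge0 s y.
have key k : 0 <= k ->
    0 <= s x x - k * `|s x y| ^+ 2 *+ 2 + k ^+ 2 * `|s x y| ^+ 2 * s y y.
  move=> k0; have := sform_ge0 s (x - (k * (s x y)^*) *: y).
  rewrite sformDr !sformDl !sformNr !sformNl !sformZr !sformZl.
  rewrite rmorphM/= conjCK opprK (CrealP (ger0_real k0)) -(sformC s x y) normCK.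
  set c := s x y; congr (0 <= _).
  rewrite mulr2n opprD expr2; set d := c^*.
  rewrite !addrA !mulrA; congr (_ + _ + _ + _).
  - by rewrite [in RHS](mulrAC k c d).
  - by rewrite (mulrAC k d k) -!mulrA; congr (k * (k * _)); rewrite mulrCA mulrA.
have [y0|y0] := eqVneq (s y y) 0.
  rewrite y0 mulr0 real_leNgt ?ger0_real ?exprn_ge0//; apply/negP => cp.
  have := key ((s x x + 1) / (`|s x y| ^+ 2 *+ 2)).
  rewrite y0 mulr0 addr0 -mulrnAr divfK ?mulrn_eq0/= ?gt_eqF//.
  rewrite opprD addrA subrr add0r oppr_ge0 ler10.
  move=> /(_ _) H; apply: notF; apply: H.
  by rewrite divr_ge0 ?addr_ge0// mulrn_wge0// ltW.
have yp : 0 < s y y by rewrite lt_def y0.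
have := key (s y y)^-1; rewrite invr_ge0 => /(_ sy).
have -> : s x x - (s y y)^-1 * `|s x y| ^+ 2 *+ 2
    + (s y y)^-1 ^+ 2 * `|s x y| ^+ 2 * s y y = s x x - `|s x y| ^+ 2 / s y y.
  by field.
rewrite subr_ge0.
by rewrite ler_pdivrMr.
Qed.

Definition snull : {pred V} := fun x => s x x == 0.

Lemma snullP x : reflect (forall y, s y x = 0) (x \in snull).
Proof.
apply: (iffP eqP) => [x0 y|]; last exact.
have := sform_CS y x; rewrite x0 mulr0 => h.
have /eqP : `|s y x| ^+ 2 = 0 by apply/eqP; rewrite eq_le h exprn_ge0.
by rewrite expf_eq0/= normr_eq0 => /eqP.
Qed.

Lemma snull_submod_closed : submod_closed snull.
Proof.
split=> [|k x y /snullP x0 /snullP y0]; apply/snullP => z.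
  by rewrite -(scale0r 0) sformZr mul0r.
by rewrite sformDr sformZr x0 y0 mulr0 addr0.
Qed.

HB.instance Definition _ := GRing.isSubmodClosed.Build R[i] V snull
  snull_submod_closed.

End SemiInnerTheory.

Section SeparatedQuotient.
Variables (R : realType) (V : lmodType R[i]) (s : semiInner V).

(* V / {x | s x x = 0} *)
Definition sepquot := Quotient.quot (snull s).
HB.instance Definition _ := GRing.Zmodule.on sepquot.
HB.instance Definition _ := EqQuotient.on sepquot.

Definition sepquot_scale (k : R[i]) (x : sepquot) : sepquot :=
  \pi_sepquot (k *: repr x).

Lemma sepquot_eqP (x y : V) :
  reflect (\pi_sepquot x = \pi_sepquot y) (x - y \in snull s).
Proof. by rewrite Quotient.idealrBE; apply: (iffP eqP). Qed.

Lemma sepquot_reprB (x : V) : repr (\pi_sepquot x) - x \in snull s.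
Proof. by apply/sepquot_eqP; rewrite reprK. Qed.

Lemma sepquot_piD (x y : V) : \pi_sepquot (x + y) = \pi_sepquot x + \pi_sepquot y.
Proof. by rewrite !piE. Qed.

Lemma sepquot_piZ (k : R[i]) (x : V) :
  \pi_sepquot (k *: x) = sepquot_scale k (\pi_sepquot x).
Proof.
apply/esym/sepquot_eqP; rewrite -scalerBr rpredZ//.
 exact: sepquot_reprB.
Qed.

Let scaleA k l x :
  sepquot_scale k (sepquot_scale l x) = sepquot_scale (k * l) x.
Proof.
by rewrite -(reprK x) -[sepquot_scale l _]sepquot_piZ -!sepquot_piZ scalerA.
Qed.

Let scale1 : left_id 1 sepquot_scale.
Proof. by move=> x; rewrite /sepquot_scale scale1r reprK. Qed.

Let scaleDr : right_distributive sepquot_scale +%R.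
Proof.
move=> k x y; rewrite -(reprK x) -(reprK y); set a := repr x; set b := repr y.
by rewrite -(sepquot_piZ k a) -(sepquot_piZ k b) -!sepquot_piD
  -(sepquot_piZ k) scalerDr.
Qed.

Let scaleDl x : {morph sepquot_scale^~ x : k l / k + l}.
Proof. by move=> k l; rewrite /sepquot_scale scalerDl sepquot_piD. Qed.

HB.instance Definition _ := GRing.Zmodule_isLmodule.Build R[i] sepquot
  scaleA scale1 scaleDr scaleDl.

Definition sepquot_proj (x : V) : sepquot := \pi_sepquot x.

Let proj_linear : linear sepquot_proj.
Proof. by move=> k x y; rewrite /sepquot_proj sepquot_piD sepquot_piZ. Qed.

HB.instance Definition _ :=
  GRing.isLinear.Build R[i] V sepquot *:%R sepquot_proj proj_linear.

Lemma sepquot_projP (x : sepquot) : exists y, sepquot_proj y = x.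
Proof. by exists (repr x); rewrite /sepquot_proj reprK. Qed.

Lemma sepquot_proj_eq0 x : (sepquot_proj x == 0) = (s x x == 0).
Proof.
rewrite -(raddf0 sepquot_proj); apply/eqP/idP => [/sepquot_eqP|x0].
  by rewrite subr0.
by apply/sepquot_eqP; rewrite subr0.
Qed.

Definition sepquot_dot (x y : sepquot) : R[i] := s (repr x) (repr y).

Lemma sepquot_dot_proj x y :
  sepquot_dot (sepquot_proj x) (sepquot_proj y) = s x y.
Proof.
rewrite /sepquot_dot -[in RHS](subrKC (repr (sepquot_proj x)) x).
rewrite -[in RHS](subrKC (repr (sepquot_proj y)) y).
have h z w : s w (z - repr (sepquot_proj z)) = 0.
  apply/snullP; rewrite -opprB rpredN; exact: sepquot_reprB.
by rewrite sformDr h addr0 sformDl -(sformC s _ (x - _)) h rmorph0 addr0.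
Qed.

Let dotDr x y z : sepquot_dot x (y + z) = sepquot_dot x y + sepquot_dot x z.
Proof.
have [{}x <-] := sepquot_projP x; have [{}y <-] := sepquot_projP y.
have [{}z <-] := sepquot_projP z.
by rewrite -raddfD !sepquot_dot_proj sformDr.
Qed.

Let dotZr k x y : sepquot_dot x (k *: y) = k * sepquot_dot x y.
Proof.
have [{}x <-] := sepquot_projP x; have [{}y <-] := sepquot_projP y.
by rewrite -linearZ !sepquot_dot_proj sformZr.
Qed.

Let dotC x y : (sepquot_dot x y)^* = sepquot_dot y x.
Proof. exact: sformC. Qed.

Let dot_ge0 x : 0 <= sepquot_dot x x.
Proof. exact: sform_ge0. Qed.

Definition sepquot_semiInner := SemiInner dotDr dotZr dotC dot_ge0.

Definition sepquot_norm (x : sepquot) : R[i] := sqrtC (sepquot_dot x x).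

Let normD x y : sepquot_norm (x + y) <= sepquot_norm x + sepquot_norm y.
Proof.
set t := sepquot_semiInner.
rewrite /sepquot_norm -[sepquot_dot]/(sform t).
have t0 := sform_ge0 t.
rewrite -(@ler_pXn2r _ 2)// ?nnegrE ?addr_ge0 ?sqrtC_ge0//.
rewrite sqrtCK sqrrD !sqrtCK sformDr !sformDl -sqrtCM ?nnegrE//.
rewrite [leLHS](_ : _ = t x x + t y y + (t x y + (t x y)^*)); last first.
  by rewrite sformC; ring.
rewrite [leRHS](_ : _ = t x x + t y y + sqrtC (t x x * t y y) *+ 2); last by ring.
rewrite lerD2l.
apply: (@le_trans _ _ (`|t x y| *+ 2)).
  have -> : t x y + (t x y)^* = 'Re (t x y) *+ 2.
    by rewrite ReE -mulr_natr divfK// pnatr_eq0.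
  by rewrite lerMn2r/= (leif_Re_Creal _).1.
rewrite lerMn2r/= -(@ler_pXn2r _ 2)// ?nnegrE ?sqrtC_ge0 ?mulr_ge0//.
by rewrite sqrtCK sform_CS.
Qed.

Let normZ k x : sepquot_norm (k *: x) = `|k| * sepquot_norm x.
Proof.
rewrite /sepquot_norm -[sepquot_dot]/(sform sepquot_semiInner).
rewrite sformZl sformZr mulrA -normCKC.
by rewrite sqrtCM ?nnegrE ?exprn_ge0 ?sform_ge0// exprCK.
Qed.

Let norm0_eq0 x : sepquot_norm x = 0 -> x = 0.
Proof.
move=> /eqP; rewrite sqrtC_eq0; have [{}x <-] := sepquot_projP x.
by rewrite sepquot_dot_proj -sepquot_proj_eq0 => /eqP.
Qed.

HB.instance Definition _ := Lmodule_isNormed.Build R[i] sepquot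
  normD normZ norm0_eq0.
HB.instance Definition _ := NormedModule_isPreHilbert.Build R sepquot
  dotDr dotZr dotC dot_ge0 (fun=> erefl).

Lemma dot_sepquot_proj x y : dot (sepquot_proj x) (sepquot_proj y) = s x y.
Proof. exact: sepquot_dot_proj. Qed.

End SeparatedQuotient.

Lemma cauchy_seqP (R : realType) (W : normedModType R[i]) (u : nat -> W) :
  cauchy (u @ \oo) <-> forall e : R[i], 0 < e ->
    exists N, forall m n, (N <= m)%N -> (N <= n)%N -> `|u m - u n| < e.
Proof.
rewrite -cauchy_ballP; split=> [h e e0|h e e0].
  have [[P Q] /= [[N1 _ P1] [N2 _ Q2]] PQ] := h e e0.
  exists (maxn N1 N2) => m n; rewrite !geq_max => /andP[m1 m2] /andP[n1 n2].
  have := PQ (u m, u n) (conj (P1 m m1) (Q2 n n2)).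
  by rewrite /= -ball_normE.
have [N hN] := h e e0.
exists (u @` [set n | (N <= n)%N], u @` [set n | (N <= n)%N]) => /=.
  by split; exists N => // n Nn; exists n.
move=> [x y] /= [[m Nm <-] [n Nn <-]]; rewrite -ball_normE /=.
exact: hN.
Qed.

Lemma cvg_seqP (R : realType) (W : normedModType R[i]) (u : nat -> W) (l : W) :
  u @ \oo --> l <-> forall e : R[i], 0 < e ->
    exists N, forall n, (N <= n)%N -> `|l - u n| < e.
Proof.
split=> [/cvgrPdist_lt h e e0|h].
  by have [N _ hN] := h e e0; exists N => n Nn; exact: hN.
apply/cvgrPdist_lt => e e0; have [N hN] := h e e0.
by exists N => // n Nn; exact: hN.
Qed.

Lemma complex_cauchy_cvg (R : realType) (u : nat -> R[i]^o) :
  cauchy (u @ \oo) -> cvg (u @ \oo).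
Proof.
move=> /cauchy_seqP cu.
have part (f : R[i] -> R) : (forall z w, f (z - w) = f z - f w) ->
    (forall z, `|f z|%:C%C <= `|z|) -> cvg ((f \o u) @ \oo).
  move=> fB fn; apply: cauchy_cvg; apply/cauchy_ballP => e e0.
  have [|N hN] := cu e%:C%C; first by rewrite ltcR.
  exists ((f \o u) @` [set n | (N <= n)%N], (f \o u) @` [set n | (N <= n)%N]).
    by split; exists N => // n Nn; exists n.
  move=> [x y] /= [[m Nm <-] [n Nn <-]]; rewrite -ball_normE /= -fB -ltcR.
  exact: le_lt_trans (fn _) (hN _ _ Nm Nn).
have cRe : cvg ((@complex.Re R \o u) @ \oo).
  apply: part => [[a b] [c d] //|[a b]]; rewrite normc_def lecR/=.
  by rewrite -sqrtr_sqr ler_wsqrtr// lerDl sqr_ge0.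
have cIm : cvg ((@complex.Im R \o u) @ \oo).
  apply: part => [[a b] [c d] //|[a b]]; rewrite normc_def lecR/=.
  by rewrite -sqrtr_sqr ler_wsqrtr// lerDr sqr_ge0.
set x := lim ((@complex.Re R \o u) @ \oo).
set y := lim ((@complex.Im R \o u) @ \oo).
apply/cvg_ex; exists (x +i* y)%C; apply/cvg_seqP => e e0.
have er : e = (complex.Re e)%:C%C by move: e0; case: (e) => a b /=; rewrite ltcE/= => /andP[/eqP -> _].
set r := complex.Re e in er.
have r0 : 0 < r by rewrite -ltcR -er.
move/cvgrPdist_lt : cRe => /(_ (r / 2)); rewrite divr_gt0// => /(_ erefl)[N1 _ h1].
move/cvgrPdist_lt : cIm => /(_ (r / 2)); rewrite divr_gt0// => /(_ erefl)[N2 _ h2].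
exists (maxn N1 N2) => n; rewrite geq_max => /andP[n1 n2].
have /= {}h1 := h1 n n1; have /= {}h2 := h2 n n2.
rewrite -/x in h1; rewrite -/y in h2.
rewrite er (splitr r) rmorphD/=.
case E : (u n) h1 h2 => [a b] /= h1 h2.
have -> : ((x +i* y)%C - (a +i* b)%C : R[i]) = (x - a)%:C%C + ('i * (y - b)%:C)%C.
  by rewrite [in RHS](_ : (_ * _)%C = 0 +i* (y - b))%C; simpc.
apply: le_lt_trans (ler_normD _ _) _; apply: ltrD.
  by rewrite normc_def/= expr0n/= addr0 sqrtr_sqr ltcR.
rewrite normrM [X in X * _]normc_def/= expr0n/= add0r expr1n sqrtr1 mul1r.
by rewrite normc_def/= expr0n/= addr0 sqrtr_sqr ltcR.
Qed.

Section PreHilbertTheory.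
Variables (R : realType) (W : preHilbertType R).
Implicit Types x y z : W.

Definition dot_semiInner : semiInner W :=
  SemiInner (@dotDr R W) (@dotZr R W) (@dotC R W) (@dot_ge0 R W).

Lemma dot_norm x : dot x x = `|x| ^+ 2.
Proof. by rewrite norm_dot sqrtCK. Qed.

Lemma dot_CS x y : `|dot x y| <= `|x| * `|y|.
Proof.
rewrite -(@ler_pXn2r _ 2)// ?nnegrE ?mulr_ge0// exprMn -!dot_norm.
exact: (sform_CS dot_semiInner).
Qed.

Lemma dotBB x y x' y' : dot x y - dot x' y' = dot (x - x') y + dot x' (y - y').
Proof.
rewrite -[dot]/(sform dot_semiInner) sformDl sformNl sformDr sformNr.
by rewrite addrA subrK.
Qed.

End PreHilbertTheory.

Lemma natSinv_lt (R : realType) (e : R[i]) : 0 < e ->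
  exists N, forall n, (N <= n)%N -> n.+1%:R^-1 < e.
Proof.
case: e => a b; rewrite ltcE/= => /andP[/eqP -> a0].
have [N _ h] := near_infty_natSinv_lt (PosNum a0).
exists N => n Nn; have /= := h n Nn.
by rewrite -ltcR rmorphV ?unitfE ?pnatr_eq0// rmorph_nat.
Qed.

Section CauchySequences.
Variables (R : realType) (W : normedModType R[i]).

Definition cauchy_seq : {pred nat -> W} := fun u => `[< cauchy (u @ \oo) >].

Lemma cauchy_seq_submod_closed : submod_closed cauchy_seq.
Proof.
split=> [|k u v /asboolP/cauchy_seqP cu /asboolP/cauchy_seqP cv];
    apply/asboolP/cauchy_seqP => e e0.
  by exists 0%N => m n _ _; rewrite subrr normr0.
have e2 : 0 < e / 2 by rewrite divr_gt0.
have k1 : 0 < `|k| + 1 by rewrite ltr_pwDr.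
have [N hN] := cu _ (divr_gt0 e2 k1); have [M hM] := cv _ e2.
exists (maxn N M) => m n; rewrite !geq_max => /andP[m1 m2] /andP[n1 n2].
rewrite [X in `|X|](_ : _ = k *: (u m - u n) + (v m - v n)); last first.
  by rewrite /= scalerBr opprD addrACA.
apply: le_lt_trans (ler_normD _ _) _; rewrite (splitr e); apply: ltr_leD; last first.
  by rewrite ltW// hM.
rewrite normrZ; have := hN m n m1 n1; rewrite ltr_pdivlMr// => h.
by apply: le_lt_trans h; rewrite mulrC ler_wpM2l// lerDl.
Qed.

HB.instance Definition _ := GRing.isSubmodClosed.Build R[i] (nat -> W) cauchy_seq
  cauchy_seq_submod_closed.

Record cauchySeq := CauchySeq {
  cauchySeq_fun :> nat -> W ;
  cauchySeq_mem : cauchySeq_fun \in cauchy_seq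
}.

HB.instance Definition _ := [isSub for cauchySeq_fun].
HB.instance Definition _ := [Choice of cauchySeq by <:].
HB.instance Definition _ := [SubChoice_isSubLmodule of cauchySeq by <:].

Lemma cauchySeqP (u : cauchySeq) (e : R[i]) : 0 < e ->
  exists N, forall m n, (N <= m)%N -> (N <= n)%N -> `|u m - u n| < e.
Proof. by move: e; apply/cauchy_seqP/asboolP/cauchySeq_mem. Qed.

Lemma cauchySeq_bounded (u : cauchySeq) :
  exists M, 0 < M /\ exists N, forall n, (N <= n)%N -> `|u n| <= M.
Proof.
have [N hN] := cauchySeqP u ltr01; exists (`|u N| + 1).
split; first by rewrite ltr_pwDr.
exists N => n Nn; rewrite -lerBlDl.
by apply: le_trans (lerB_dist _ _) (ltW (hN _ _ _ _)).
Qed.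

Lemma cst_cauchy_seq (w : W) : (fun=> w) \in cauchy_seq.
Proof.
apply/asboolP/cauchy_seqP => e e0.
by exists 0%N => m n _ _; rewrite subrr normr0.
Qed.

Definition cstSeq (w : W) : cauchySeq := CauchySeq (cst_cauchy_seq w).

End CauchySequences.

Section LimitForm.
Variables (R : realType) (W : preHilbertType R).
Implicit Types u v w : cauchySeq W.

Definition lim_dot u v : R[i] :=
  lim ((fun n => dot (u n) (v n) : R[i]^o) @ \oo).

Lemma lim_dot_cvg u v : (fun n => dot (u n) (v n) : R[i]^o) @ \oo --> (lim_dot u v : R[i]^o).
Proof.
apply: complex_cauchy_cvg; apply/cauchy_seqP => e e0.
have [M [M0 [N1 h1]]] := cauchySeq_bounded v.
have [M' [M0' [N2 h2]]] := cauchySeq_bounded u.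
have e2 : 0 < e / 2 by rewrite divr_gt0.
have [N3 h3] := cauchySeqP u (divr_gt0 e2 M0).
have [N4 h4] := cauchySeqP v (divr_gt0 e2 M0').
exists (maxn (maxn N1 N2) (maxn N3 N4)) => m n.
rewrite !geq_max => /andP[/andP[m1 m2] /andP[m3 m4]] /andP[/andP[n1 n2] /andP[n3 n4]].
rewrite dotBB (splitr e); apply: le_lt_trans (ler_normD _ _) _; apply: ltrD.
  apply: le_lt_trans (dot_CS _ _) _; have := h3 m n m3 n3.
  by rewrite ltr_pdivlMr// => h; apply: le_lt_trans h; rewrite ler_wpM2l// h1.
apply: le_lt_trans (dot_CS _ _) _; have := h4 m n m4 n4.
by rewrite ltr_pdivlMr// mulrC => h; apply: le_lt_trans h; rewrite ler_wpM2r// h2.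
Qed.

Lemma lim_dotE u v l :
  (fun n => dot (u n) (v n) : R[i]^o) @ \oo --> (l : R[i]^o) -> lim_dot u v = l.
Proof. by move=> h; apply: (@cvg_lim R[i]^o) => //; exact: norm_hausdorff. Qed.

Let limDr u v w : lim_dot u (v + w) = lim_dot u v + lim_dot u w.
Proof.
apply: lim_dotE; rewrite [X in X @ _](_ : _ = (fun n => dot (u n) (v n) : R[i]^o) +
  (fun n => dot (u n) (w n) : R[i]^o)); last by apply/funext => n /=; rewrite dotDr.
apply: cvgD; exact: lim_dot_cvg.
Qed.

Let limZr k u v : lim_dot u (k *: v) = k * lim_dot u v.
Proof.
apply: lim_dotE.
rewrite [X in X @ _](_ : _ = k \*: (fun n => dot (u n) (v n) : R[i]^o)); last first.
  by apply/funext => n /=; rewrite dotZr.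
by apply: cvgZl_tmp; exact: lim_dot_cvg.
Qed.

Let limC u v : (lim_dot u v)^* = lim_dot v u.
Proof.
apply/esym/lim_dotE/cvg_seqP => e e0.
have /cvg_seqP/(_ e e0)[N hN] := @lim_dot_cvg u v.
by exists N => n Nn; rewrite -dotC -rmorphB/= norm_conjC; exact: hN.
Qed.

Lemma lim_ge0 (f : nat -> R[i]^o) (l : R[i]^o) :
  (exists N, forall n, (N <= n)%N -> 0 <= f n :> R[i]) -> f @ \oo --> l ->
  0 <= l :> R[i].
Proof.
move=> [N0 f0] fl; suff -> : (l : R[i]) = `|(l : R[i])| by [].
have h e : 0 < e -> `|(l : R[i]) - `|(l : R[i])| | < e.
  move=> e0; have e2 : 0 < e / 2 by rewrite divr_gt0.
  have /cvg_seqP/(_ _ e2)[N /(_ (maxn N0 N))] := fl.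
  rewrite leq_maxr => /(_ isT) hl.
  rewrite -[X in `|X|](subrKA (f (maxn N0 N) : R[i])).
  rewrite (splitr e); apply: le_lt_trans (ler_normD _ _) _; apply: ltrD => //.
  rewrite -[X in `|X - _|]ger0_norm ?f0 ?leq_maxl//.
  by apply: le_lt_trans (ler_dist_dist _ _) _; rewrite distrC.
apply/eqP; rewrite -subr_eq0 -normr_le0 real_leNgt ?ger0_real//.
by apply/negP => /h; rewrite ltxx.
Qed.

Let limge0 u : 0 <= lim_dot u u.
Proof.
by apply: lim_ge0 (@lim_dot_cvg u u); exists 0%N => n _; exact: dot_ge0.
Qed.

Definition lim_semiInner := SemiInner limDr limZr limC limge0.

End LimitForm.

Section Completion.
Variables (R : realType) (W : preHilbertType R).

(* Cauchy sequences of W modulo those whose norm tends to 0 *)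
Definition completion := sepquot (lim_semiInner W).
HB.instance Definition _ := PreHilbert.on completion.

Definition completion_map (w : W) : completion := sepquot_proj _ (cstSeq w).

Let completion_map_linear : linear completion_map.
Proof.
move=> k x y; rewrite /completion_map -linearP; congr sepquot_proj.
by apply: val_inj; rewrite linearP.
Qed.

HB.instance Definition _ :=
  GRing.isLinear.Build R[i] W completion *:%R completion_map completion_map_linear.

Lemma dot_completion_map x y : dot (completion_map x) (completion_map y) = dot x y.
Proof.
rewrite dot_sepquot_proj; apply: lim_dotE.
exact: (@cvg_cst (R[i]^o) (dot x y)).
Qed.

Lemma norm_completion_map x : `|completion_map x| = `|x|.
Proof. by rewrite !norm_dot dot_completion_map. Qed.

Lemma norm_sepquot_proj_le (u : cauchySeq W) (e : R[i]) : 0 <= e ->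
  (exists N, forall n, (N <= n)%N -> `|u n| <= e) ->
  `|sepquot_proj (lim_semiInner W) u| <= e.
Proof.
move=> e0 [N hN].
rewrite -(@ler_pXn2r _ 2)// ?nnegrE// -dot_norm dot_sepquot_proj -subr_ge0.
have h : (fun n => e ^+ 2 - dot (u n) (u n) : R[i]^o) @ \oo -->
    (e ^+ 2 - lim_dot u u : R[i]^o).
  by apply: cvgB; [exact: cvg_cst|exact: lim_dot_cvg].
apply: lim_ge0 h; exists N => n Nn; rewrite subr_ge0 dot_norm.
by rewrite ler_pXn2r// ?nnegrE//; exact: hN.
Qed.

Lemma completion_map_approx (u : cauchySeq W) (e : R[i]) : 0 < e ->
  exists N, forall n, (N <= n)%N ->
    `|sepquot_proj (lim_semiInner W) u - completion_map (u n)| <= e.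
Proof.
move=> e0; have [N hN] := cauchySeqP u e0; exists N => n Nn.
rewrite /completion_map -raddfB; apply: norm_sepquot_proj_le; first exact: ltW.
by exists N => m Nm; apply/ltW; exact: hN.
Qed.

Lemma completion_map_dense : dense (range completion_map).
Proof.
move=> O [x Ox] oO; have : nbhs x O by exact: open_nbhs_nbhs.
move=> /nbhs_normP[e /= e0 he]; have [u ux] := sepquot_projP x.
have e2 : 0 < e / 2 by rewrite divr_gt0.
have [N /(_ N (leqnn _)) hN] := completion_map_approx u e2.
exists (completion_map (u N)); split; last by exists (u N).
apply: he => /=; rewrite -ux; apply: le_lt_trans hN _.
by rewrite ltr_pdivrMr// mulr_natr mulr2n ltrDl.
Qed.

Let completion_cauchy_cvg (F : set_system completion) :
  ProperFilter F -> cauchy F -> cvg F.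
Proof.
move=> PF /cauchyP cF.
have pos n : 0 < n.+1%:R^-1 :> R[i] by rewrite invr_gt0 ltr0n.
have [x hx] := choice (fun n => cF _ (pos n)).
have /choice[w hw] n : exists w, `|x n - completion_map w| < n.+1%:R^-1.
  have [u ux] := sepquot_projP (x n).
  have e2 : 0 < n.+1%:R^-1 / 2 :> R[i] by rewrite divr_gt0.
  have [N /(_ N (leqnn _)) hN] := completion_map_approx u e2.
  exists (u N); rewrite -ux; apply: le_lt_trans hN _.
  by rewrite ltr_pdivrMr// mulr_natr mulr2n ltrDl.
have xx m n : `|x m - x n| < m.+1%:R^-1 + n.+1%:R^-1.
  have [z []] := filter_ex (filterI (hx m) (hx n)).
  rewrite -!ball_normE /= => zm zn.
  rewrite -(subrKA z); apply: le_lt_trans (ler_normD _ _) _.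
  by apply: ltrD => //; rewrite distrC.
have cw : w \in @cauchy_seq R W.
  apply/asboolP/cauchy_seqP => e e0.
  have e4 : 0 < e / 2 / 2 by rewrite !divr_gt0.
  have [N hN] := natSinv_lt e4; exists N => m n Nm Nn.
  rewrite -norm_completion_map raddfB.
  rewrite -(subrKA (x m)) -[X in _ + X](subrKA (x n)).
  have -> : e = e / 2 / 2 + (e / 2 / 2 + e / 2 / 2 + e / 2 / 2) by field.
  apply: le_lt_trans (ler_normD _ _) _; apply: ltrD.
    by rewrite distrC; apply: lt_trans (hN m Nm).
  apply: le_lt_trans (ler_normD _ _) _; apply: ltrD.
    by apply: lt_trans (xx m n) _; apply: ltrD; exact: hN.
  by apply: lt_trans (hN n Nn).
set q := sepquot_proj (lim_semiInner W) (CauchySeq cw).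
apply/cvg_ex; exists (q : completion); apply/cvgrPdist_lt => e e0.
have e4 : 0 < e / 2 / 2 by rewrite !divr_gt0.
have [N1 h1] := completion_map_approx (CauchySeq cw) e4.
have [N2 h2] := natSinv_lt e4.
pose n := maxn N1 N2.
have {}h1 := h1 n (leq_maxl _ _); have {}h2 := h2 n (leq_maxr _ _).
apply: filterS (hx n) => y; rewrite -ball_normE /= => xy.
rewrite -(subrKA (completion_map (w n))) -[X in _ + X](subrKA (x n)).
rewrite (splitr e); apply: le_lt_trans (ler_normD _ _) _.
apply: ler_ltD.
  by apply: le_trans h1 _; rewrite ler_pdivrMr// mulr_natr mulr2n lerDl ltW// divr_gt0.
apply: le_lt_trans (ler_normD _ _) _; rewrite (splitr (e / 2)); apply: ltrD.
  by rewrite distrC; apply: lt_trans (hw n) h2.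
exact: lt_trans xy h2.
Qed.

HB.instance Definition _ := Uniform_isComplete.Build completion
  completion_cauchy_cvg.

End Completion.

Section Localization.
Variables (R : realType) (A : cstarAlgType R) (E : hilbertCModType A).
Variable w : state A.
Implicit Types x y z : E.

Definition state_inner x y : R[i] := w (inner x y).

Let sDr x y z : state_inner x (y + z) = state_inner x y + state_inner x z.
Proof. by rewrite /state_inner innerDr raddfD. Qed.

Let sZr (k : R[i]) x y : state_inner x (k *: y) = k * state_inner x y.
Proof. by rewrite /state_inner innerZr linearZ. Qed.

Let s_ge0 x : 0 <= state_inner x x.
Proof. exact/state_ge0/inner_ge0. Qed.

Let sC x y : (state_inner x y)^* = state_inner y x.
Proof.
have sDl a b c : state_inner (a + b) c = state_inner a c + state_inner b c.
  by rewrite /state_inner -inner_star innerDr cstarD !inner_star raddfD.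
have sZl (k : R[i]) a b : state_inner (k *: a) b = k^* * state_inner a b.
  by rewrite /state_inner -inner_star innerZr cstarZ inner_star linearZ.
have real (z : E) : (state_inner z z)^* = state_inner z z.
  exact/CrealP/ger0_real/s_ge0.
have := real (x + y); have := real (x + 'i *: y).
rewrite !sDr !sDl !sZr !sZl !rmorphD/= !real !rmorphM/= !conjCK !conjCi.
rewrite !real; set p := state_inner x y; set q := state_inner y x.
set a := state_inner x x; set b := state_inner y y.
move: p^* q^* => p' q'; clearbody p q a b => h1 h2.
have {}h2 : p' + q' = p + q.
  apply: (addrI (a + b)); rewrite [RHS](_ : _ = a + q + (p + b)); last by ring.
  by rewrite -h2; ring.
have {}h1 : p' - q' = q - p.
  move: (neq0Ci R[i]) h1; move: 'i => j j0 h1; apply: (mulfI j0).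
  rewrite [LHS](_ : _ = a - j * (j * b) -
    (a + j * q' + (- j * p' + - j * (j * b)))); last by ring.
  by rewrite h1; ring.
have h3 : p' *+ 2 = q *+ 2.
  rewrite [LHS](_ : _ = (p' + q') + (p' - q')); last by ring.
  by rewrite h1 h2; ring.
by move/eqP: h3; rewrite -subr_eq0 -mulrnBl mulrn_eq0/= subr_eq0 => /eqP.
Qed.

Definition state_semiInner := SemiInner sDr sZr sC s_ge0.

(* the Hilbert space E^w, that is, the completion of E / N_w *)
Definition localization := completion (sepquot state_semiInner).
HB.instance Definition _ := Hilbert.on localization.

Definition loc_map (x : E) : localization :=
  completion_map (sepquot_proj state_semiInner x).

Let loc_map_linear : linear loc_map.
Proof. by move=> k x y; rewrite /loc_map !linearP. Qed.

HB.instance Definition _ :=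
  GRing.isLinear.Build R[i] E localization *:%R loc_map loc_map_linear.

Lemma dot_loc_map x y : dot (loc_map x) (loc_map y) = w (inner x y).
Proof. by rewrite dot_completion_map dot_sepquot_proj. Qed.

Lemma loc_map_dense : dense (range loc_map).
Proof.
move=> O O0 oO; have [z [Oz [y _ yz]]] := completion_map_dense O0 oO; subst z.
have [x xy] := sepquot_projP y.
by exists (loc_map x); split; [rewrite /loc_map xy|by exists x].
Qed.

End Localization.

(* Main.v *)
Require Import Defs.
From HB Require Import structures.
From mathcomp Require Import all_boot all_order all_algebra complex ring lra.
From mathcomp Require Import all_classical all_reals all_analysis.

Set Implicit Arguments.
Unset Strict Implicit.
Unset Printing Implicit Defensive.

Import Order.TTheory GRing.Theory Num.Theory.
Import numFieldNormedType.Exports.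

Local Open Scope classical_set_scope.
Local Open Scope ring_scope.

(** The point [x0] lies at some distance [d > 0] from [L]. Let [K] be the set of
    the elements of [A] that dominate [<y - x0, y - x0>] for some [y] in [L].
    It is convex, because for real [s + t = 1]
      [s <u, u> + t <v, v> - <s u + t v, s u + t v> = s t <u - v, u - v>]
    is positive ([inner_convex_comb]); and since [0 <= a <= b] forces
    [|a| <= |b|], all its elements have norm at least [d^2]. So the theorem of
    Hahn and Banach separates [K] from the open ball of radius [d^2]: some
    functional [F] of norm at most 1 has real part at least [d^2] on [K]
    ([separation_from_ball]). As [K] is stable under the addition of positive
    elements, [Re F] cannot be negative on any of them, and the normalised
    hermitian part of [F] is a state [w] ([state_of_functional]). It is bounded
    away from 0 on the elements [<y - x0, y - x0>], which says that the image of
    [x0] in the Hilbert space of [w] is far from the image of [L]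
    ([state_far]). When [L] is a submodule, its image is a subspace, and the
    difference between the image of [x0] and its projection on the closure of
    that subspace is a nonzero vector of the complement ([orthocompl_neq0]).

    What this takes from the theory of C*-algebras is that the elements [b^* b]
    lie in a convex cone on whose order the norm is monotone
    ([upos_star_mul], [ler_rnorm_upos]). Both facts are proved without spectral
    theory, in the unitization of [A]. There, a hermitian [x] is called positive
    when [|t - x| <= t] for some real [t], so that sums of positive elements
    are positive by the triangle inequality. An iteration gives a square root
    of [1 - h] for every hermitian [h] of norm at most 1, hence of every positive
    element, commuting with all that commutes with the element. The
    other tool is that if [s] and [z] are commuting hermitian elements with
    [s^2 + z^2 = t], then [s + i z] is [sqrt t] times a unitary, so that
    [|s| <= sqrt t]. It shows that hermitian squares are positive and that
    [0 <= x <= t] implies [|x| <= t]. Positivity of [x^* x] then follows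
    Kaplansky: cutting [x] down to the negative part of [x^* x] yields [y] with
    [- y^* y] positive, and such a [y] vanishes ([ustar_mul_neg_eq0]). *)

(** * Real-valued norms *)

Section RealNorm.
Variable R : realType.

(** Norms of modules over [R[i]] are complex numbers; the real version lives in an
    ordered field. *)
Definition rnorm (V : normedModType R[i]) (x : V) : R := complex.Re `|x|.

Lemma Re_realC (z : R[i]) : z \is Num.real -> (complex.Re z)%:C%C = z.
Proof.
by case: z => a b; rewrite realE !lecE/= => /orP[/andP[/eqP ->]|/andP[/eqP <-]].
Qed.

Lemma ReM_real (t : R) (z : R[i]) : complex.Re (t%:C%C * z) = t * complex.Re z.
Proof. by case: z => a b; simpc. Qed.

Variable (V : normedModType R[i]).
Implicit Types x y : V.

Lemma rnormE x : (rnorm x)%:C%C = `|x|.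
Proof. by rewrite /rnorm Re_realC ?normr_real. Qed.

Lemma rnorm_ge0 x : 0 <= rnorm x.
Proof. by rewrite -lecR rnormE normr_ge0. Qed.

Lemma rnorm0 : rnorm (0 : V) = 0.
Proof. by rewrite /rnorm normr0. Qed.

Lemma rnorm_eq0 x : rnorm x = 0 -> x = 0.
Proof. by move=> h; apply/normr0_eq0; rewrite -rnormE h. Qed.

Lemma ler_rnormD x y : rnorm (x + y) <= rnorm x + rnorm y.
Proof. by rewrite -lecR rmorphD/= !rnormE ler_normD. Qed.

Lemma rnormN x : rnorm (- x) = rnorm x.
Proof. by rewrite /rnorm normrN. Qed.

Lemma rnormB x y : rnorm (x - y) = rnorm (y - x).
Proof. by rewrite -rnormN opprB. Qed.

Lemma rnormZ (k : R[i]) x : rnorm (k *: x) = complex.Re `|k| * rnorm x.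
Proof. by rewrite /rnorm normrZ -ReM_real Re_realC. Qed.

Lemma rnormZr (t : R) x : rnorm (t%:C%C *: x) = `|t| * rnorm x.
Proof. by rewrite rnormZ normc_def/= expr0n addr0 sqrtr_sqr. Qed.

End RealNorm.

Section RealNormLimits.
Variables (R : realType) (V : normedModType R[i]).
Implicit Types (u : nat -> V).

Lemma gt0_realC (e : R[i]) : 0 < e -> 0 < complex.Re e /\ (complex.Re e)%:C%C = e.
Proof.
by move=> e0; have ee := Re_realC (gtr0_real e0); rewrite -ltcR ee.
Qed.

Lemma cauchy_rnorm u :
  (forall e : R, 0 < e -> exists N, forall m n, (N <= m)%N -> (N <= n)%N ->
     rnorm (u m - u n) < e) -> cauchy (u @ \oo).
Proof.
move=> h; apply/cauchy_seqP => e /gt0_realC[e0 <-].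
have [N hN] := h _ e0; exists N => m n Nm Nn.
by rewrite -rnormE ltcR; exact: hN.
Qed.

Lemma cvg_rnormP u (l : V) :
  u @ \oo --> l <-> forall e : R, 0 < e -> exists N, forall n, (N <= n)%N ->
     rnorm (l - u n) < e.
Proof.
split=> [/cvg_seqP h e e0|h].
  have [|N hN] := h e%:C%C; first by rewrite ltcR.
  by exists N => n /hN; rewrite -rnormE ltcR.
apply/cvg_seqP => e /gt0_realC[e0 <-]; have [N hN] := h _ e0.
by exists N => n Nn; rewrite -rnormE ltcR; exact: hN.
Qed.

End RealNormLimits.

(** * The unitization of a C*-algebra *)

Section Unitization.
Variables (R : realType) (A : cstarAlgType R).
Implicit Types a b : A.

Lemma cmul0l a : cmul 0 a = 0.
Proof. by rewrite -(scale0r 0) cmulZl !scale0r. Qed.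

Lemma cmul0r a : cmul a 0 = 0.
Proof. by rewrite -(scale0r 0) cmulZr !scale0r. Qed.

Lemma cstar0 : cstar 0 = 0 :> A.
Proof. by rewrite -(scale0r 0) cstarZ rmorph0 !scale0r. Qed.

Lemma rnorm_cmul a b : rnorm (cmul a b) <= rnorm a * rnorm b.
Proof. by rewrite -lecR rmorphM/= !rnormE cnormM. Qed.

Lemma rnorm_cstar_mul a : rnorm (cmul (cstar a) a) = rnorm a ^+ 2.
Proof.
by apply/eqP; rewrite -(inj_eq (@complexI R)) rmorphXn/= !rnormE cnorm_star.
Qed.

Lemma rnorm_cstar a : rnorm (cstar a) = rnorm a.
Proof.
have le b : rnorm b <= rnorm (cstar b).
  have := rnorm_cmul (cstar b) b; rewrite rnorm_cstar_mul expr2.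
  have [/eqP b0|b0] := eqVneq (rnorm b) 0.
    by rewrite (eqP b0) rnorm_ge0.
  by rewrite ler_pM2r// lt_def b0 rnorm_ge0.
by apply/eqP; rewrite eq_le le andbT; have := le (cstar a); rewrite cstarK.
Qed.

Definition unitization : Type := (A * R[i]^o)%type.
HB.instance Definition _ := GRing.Lmodule.on unitization.

Definition umul (x y : unitization) : unitization :=
  (cmul x.1 y.1 + x.2 *: y.1 + y.2 *: x.1, x.2 * y.2).

Let umulA : associative umul.
Proof.
move=> [a k] [b l] [c m]; rewrite /umul/=; congr pair; last by rewrite mulrA.
rewrite !cmulDl !cmulDr !scalerDr !cmulZl !cmulZr cmulA !scalerA.
rewrite -!addrA; congr (_ + _).
by rewrite (mulrC m k) (mulrC m l) !addrA [LHS](ACl (3*1*4*2*5*6)).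
Qed.

Let umul1l : left_id ((0, 1) : unitization) umul.
Proof.
by move=> [a k]; rewrite /umul/= cmul0l scale1r scaler0 addr0 add0r mul1r.
Qed.

Let umul1r : right_id ((0, 1) : unitization) umul.
Proof.
by move=> [a k]; rewrite /umul/= cmul0r scale1r scaler0 addr0 add0r mulr1.
Qed.

Let umulDl : left_distributive umul +%R.
Proof.
move=> [a k] [b l] [c m]; rewrite /umul/=; congr pair; last by rewrite /= mulrDl.
rewrite /= cmulDl scalerDl scalerDr !addrA.
by rewrite [RHS](ACl (1*4*2*5*3*6)).
Qed.

Let umulDr : right_distributive umul +%R.
Proof.
move=> [a k] [b l] [c m]; rewrite /umul/=; congr pair; last by rewrite /= mulrDr.
rewrite /= cmulDr scalerDl scalerDr !addrA.
by rewrite [RHS](ACl (1*4*2*5*3*6)).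
Qed.

Let one_neq0 : ((0, 1) : unitization) != 0.
Proof. by apply/eqP => -[/eqP]; rewrite oner_eq0. Qed.

HB.instance Definition _ := GRing.Zmodule_isNzRing.Build unitization
  umulA umul1l umul1r umulDl umulDr one_neq0.

Let scale_umulAl (k : R[i]) (x y : unitization) : k *: (x * y) = (k *: x) * y.
Proof.
case: x y => [a l] [b m]; congr pair; last by rewrite /= -scalerAl.
by rewrite /= !scalerDr cmulZl !scalerA (mulrC k m).
Qed.

HB.instance Definition _ :=
  GRing.Lmodule_isLalgebra.Build R[i] unitization scale_umulAl.

Let scale_umulAr (k : R[i]) (x y : unitization) : k *: (x * y) = x * (k *: y).
Proof.
case: x y => [a l] [b m]; congr pair; last by rewrite /= -scalerAr.
by rewrite /= !scalerDr cmulZr !scalerA (mulrC k l).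
Qed.

HB.instance Definition _ :=
  GRing.Lalgebra_isAlgebra.Build R[i] unitization scale_umulAr.

Definition ustar (x : unitization) : unitization := (cstar x.1, x.2^*).

Lemma ustarK : involutive ustar.
Proof. by move=> [a k]; rewrite /ustar/= cstarK conjCK. Qed.

Lemma ustar0 : ustar 0 = 0.
Proof. by rewrite /ustar/= cstar0 rmorph0. Qed.

Lemma ustarD x y : ustar (x + y) = ustar x + ustar y.
Proof. by case: x y => [a k] [b l]; rewrite /ustar/= cstarD rmorphD. Qed.

Lemma ustarZ (k : R[i]) x : ustar (k *: x) = k^* *: ustar x.
Proof. by case: x => [a l]; rewrite /ustar/= cstarZ rmorphM. Qed.

Lemma ustarN x : ustar (- x) = - ustar x.
Proof. by rewrite -scaleN1r ustarZ rmorphN1 scaleN1r. Qed.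

Lemma ustarM x y : ustar (x * y) = ustar y * ustar x.
Proof.
case: x y => [a k] [b l]; congr pair; last by rewrite /= rmorphM mulrC.
by rewrite /= !cstarD cstarM !cstarZ -!addrA; congr (_ + _); rewrite addrC.
Qed.

Lemma ustar1 : ustar 1 = 1.
Proof. by rewrite /ustar/= cstar0 rmorph1. Qed.

Lemma ustarZr (t : R) x : ustar (t%:C%C *: x) = t%:C%C *: ustar x.
Proof. by rewrite ustarZ; congr (_ *: _); apply/CrealP; rewrite complex_real. Qed.

Definition uinj (a : A) : unitization := (a, 0).

Lemma uinjD a b : uinj (a + b) = uinj a + uinj b.
Proof. by congr pair; rewrite /= addr0. Qed.

Lemma uinjZ (k : R[i]) a : uinj (k *: a) = k *: uinj a.
Proof. by congr pair; rewrite /= scaler0. Qed.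

Lemma uinjM a b : uinj (cmul a b) = uinj a * uinj b.
Proof. by congr pair; rewrite /= ?mulr0// !scale0r !addr0. Qed.

Lemma ustar_inj a : ustar (uinj a) = uinj (cstar a).
Proof. by rewrite /ustar/= rmorph0. Qed.

Definition uact (x : unitization) (b : A) : A := cmul x.1 b + x.2 *: b.

Lemma uinj_act x b : uinj (uact x b) = x * uinj b.
Proof. by congr pair; rewrite /= ?mulr0// scale0r addr0. Qed.

Lemma uinj_inj : injective uinj.
Proof. by move=> a b []. Qed.

Lemma uactD x y b : uact (x + y) b = uact x b + uact y b.
Proof. by apply: uinj_inj; rewrite uinjD !uinj_act mulrDl. Qed.

Lemma uactZ (k : R[i]) x b : uact (k *: x) b = k *: uact x b.
Proof. by apply: uinj_inj; rewrite uinjZ !uinj_act scalerAl. Qed.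

Lemma uactM x y b : uact (x * y) b = uact x (uact y b).
Proof. by apply: uinj_inj; rewrite !uinj_act mulrA. Qed.

Lemma uact_inj a b : uact (uinj a) b = cmul a b.
Proof. by rewrite /uact/= scale0r addr0. Qed.

(** The left side is [|b^* (x^* x b)|], by the C*-identity in [A]. *)
Lemma rnorm_uact_sqr x b :
  rnorm (uact x b) ^+ 2 <= rnorm b * rnorm (uact (ustar x * x) b).
Proof.
rewrite -rnorm_cstar_mul.
have -> : cmul (cstar (uact x b)) (uact x b) =
    cmul (cstar b) (uact (ustar x * x) b).
  apply: uinj_inj; rewrite !uinjM -!ustar_inj !uinj_act ustarM.
  by rewrite !mulrA.
by apply: le_trans (rnorm_cmul _ _) _; rewrite rnorm_cstar.
Qed.

(** The relation [|x| <= M] for the C*-norm of the unitization, which is the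
    larger of the modulus of the scalar part of [x] and of the norm of the left
    multiplication by [x] on [A]. The second term alone is a norm only when [A]
    has no unit: it kills [(e, -1)] if [e] is one. *)
Definition ubnd (x : unitization) (M : R) : Prop :=
  rnorm x.2 <= M /\ forall b, rnorm (uact x b) <= M * rnorm b.

Lemma ubnd_ge0 x M : ubnd x M -> 0 <= M.
Proof. by case=> /(le_trans (rnorm_ge0 _)). Qed.

Lemma ubnd_le x M N : M <= N -> ubnd x M -> ubnd x N.
Proof.
move=> MN [h1 h2]; split; first exact: le_trans MN.
by move=> b; apply: le_trans (h2 b) _; rewrite ler_wpM2r// rnorm_ge0.
Qed.

Lemma ubnd0 : ubnd 0 0.
Proof.
split=> [|b]; first by rewrite rnorm0.
by rewrite /uact/= cmul0l scale0r addr0 rnorm0 mul0r.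
Qed.

Lemma ubnd1 : ubnd 1 1.
Proof.
split=> [|b]; first by rewrite /rnorm normr1.
by rewrite /uact/= cmul0l scale1r add0r mul1r.
Qed.

Lemma ubndD x y M N : ubnd x M -> ubnd y N -> ubnd (x + y) (M + N).
Proof.
move=> [x1 x2] [y1 y2]; split=> [|b].
  by apply: le_trans (ler_rnormD _ _) _; exact: lerD.
rewrite uactD; apply: le_trans (ler_rnormD _ _) _.
by rewrite mulrDl lerD.
Qed.

Lemma ubndZ (k : R[i]) x M : ubnd x M -> ubnd (k *: x) (complex.Re `|k| * M).
Proof.
have k0 : 0 <= complex.Re `|k| by exact: (rnorm_ge0 (k : R[i]^o)).
move=> [x1 x2]; split=> [|b].
  by rewrite rnormZ ler_wpM2l.
by rewrite uactZ rnormZ -mulrA ler_wpM2l.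
Qed.

Lemma ubndZr (t : R) x M : ubnd x M -> ubnd (t%:C%C *: x) (`|t| * M).
Proof.
by move=> /(ubndZ t%:C%C); rewrite normc_def/= expr0n addr0 sqrtr_sqr.
Qed.

Lemma ubndN x M : ubnd x M -> ubnd (- x) M.
Proof. by move=> /(ubndZ (-1)); rewrite normrN1 mul1r scaleN1r. Qed.

Lemma ubndB x y M N : ubnd x M -> ubnd y N -> ubnd (x - y) (M + N).
Proof. by move=> ? ?; apply/ubndD => //; exact: ubndN. Qed.

Lemma ubndM x y M N : ubnd x M -> ubnd y N -> ubnd (x * y) (M * N).
Proof.
move=> ux uy; have M0 := ubnd_ge0 ux; have N0 := ubnd_ge0 uy.
case: ux uy => [x1 x2] [y1 y2]; split=> [|b].
  rewrite [X in rnorm X](_ : _ = (x.2 : R[i]) *: (y.2 : R[i]^o))// rnormZ.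
  apply: ler_pM => //; first exact: (rnorm_ge0 x.2).
  exact: rnorm_ge0.
rewrite uactM; apply: le_trans (x2 _) _.
by rewrite -mulrA ler_wpM2l.
Qed.

(** The half of the C*-identity of the unitization that bounds [|x|]. *)
Lemma ubnd_star_mul x M : 0 <= M -> ubnd (ustar x * x) (M ^+ 2) -> ubnd x M.
Proof.
move=> M0 [x1 x2]; split=> [|b].
  rewrite -(@ler_pXn2r _ 2)// ?nnegrE ?rnorm_ge0//.
  apply: le_trans x1; rewrite [X in _ <= rnorm X](_ : _ = (x.2^* : R[i]) *: x.2)//.
  by rewrite rnormZ norm_conjC expr2.
rewrite -(@ler_pXn2r _ 2)// ?nnegrE ?mulr_ge0 ?rnorm_ge0//.
apply: le_trans (rnorm_uact_sqr _ _) _.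
by rewrite exprMn [in leRHS]expr2 mulrCA ler_wpM2l// ?rnorm_ge0//.
Qed.

Lemma ubnd_star x M : ubnd x M -> ubnd (ustar x) M.
Proof.
move=> ux; have M0 := ubnd_ge0 ux; case: ux => [x1 x2]; split=> [|b].
  rewrite [leLHS](_ : _ = rnorm x.2)//.
  by congr complex.Re; exact: norm_conjC.
have [/eqP b0|b0] := eqVneq (rnorm (uact (ustar x) b)) 0.
  by rewrite (eqP b0) mulr_ge0 ?rnorm_ge0.
have bp : 0 < rnorm (uact (ustar x) b) by rewrite lt_def b0 rnorm_ge0.
rewrite -(ler_pM2l bp) -expr2; apply: le_trans (rnorm_uact_sqr _ _) _.
rewrite ustarK uactM mulrA [leRHS]mulrC (mulrC _ M).
by rewrite ler_wpM2l// rnorm_ge0.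
Qed.

Lemma ubnd_inj a : ubnd (uinj a) (rnorm a).
Proof.
split=> [|b]; first by rewrite rnorm0 rnorm_ge0.
by rewrite uact_inj rnorm_cmul.
Qed.

(** Left multiplication by [a] attains the norm of [a] at [a^*], up to scaling, so
    the inclusion of [A] in its unitization is isometric. *)
Lemma rnorm_le_ubnd a M : ubnd (uinj a) M -> rnorm a <= M.
Proof.
move=> ua; have M0 := ubnd_ge0 ua; case: ua => [_ /(_ (cstar a))].
rewrite uact_inj; have := rnorm_cstar_mul (cstar a).
rewrite cstarK rnorm_cstar => -> .
have [/eqP a0|a0] := eqVneq (rnorm a) 0; first by rewrite (eqP a0).
by rewrite expr2 ler_pM2r// lt_def a0 rnorm_ge0.
Qed.

Lemma ubnd_pair x : ubnd x (rnorm x.1 + rnorm x.2).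
Proof.
split=> [|b]; first by rewrite lerDr rnorm_ge0.
rewrite /uact; apply: le_trans (ler_rnormD _ _) _.
by rewrite rnormZ mulrDl lerD2r rnorm_cmul.
Qed.

Lemma ubnd_ex x : exists2 M, 0 < M & ubnd x M.
Proof.
exists (rnorm x.1 + rnorm x.2 + 1); last first.
  by apply: ubnd_le (ubnd_pair x); rewrite lerDl.
by rewrite ltr_wpDl// addr_ge0// rnorm_ge0.
Qed.

Lemma ubnd_eps x M : (forall e, 0 < e -> ubnd x (M + e)) -> ubnd x M.
Proof.
move=> h; split=> [|b]; apply/ler_addgt0Pr => e e0.
  by have [] := h _ e0.
have b1 : 0 < rnorm b + 1 by rewrite ltr_wpDl// rnorm_ge0.
have [_ /(_ b)/le_trans->//] := h _ (divr_gt0 e0 b1).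
rewrite mulrDl lerD2l -mulrA ler_piMr ?(ltW e0)//.
by rewrite mulrC ler_pdivrMr// mul1r lerDl.
Qed.

Lemma ubnd_eq0 x : ubnd x 0 -> x = 0.
Proof.
case: x => a k [/= k0 h].
have {}k0 : k = 0.
  by apply: (rnorm_eq0 (V := R[i]^o)); apply/eqP; rewrite eq_le k0 rnorm_ge0.
rewrite {}k0 in h *; congr pair; apply: rnorm_eq0; apply/eqP.
by rewrite eq_le rnorm_ge0 rnorm_le_ubnd//; split; rewrite ?rnorm0.
Qed.

Lemma ubnd_eps0 x : (forall e, 0 < e -> ubnd x e) -> x = 0.
Proof. by move=> h; apply/ubnd_eq0/ubnd_eps => e; rewrite add0r; exact: h. Qed.

Lemma ubnd_fst x M : ubnd x M -> rnorm x.1 <= M + M.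
Proof.
move=> ux; apply: rnorm_le_ubnd.
have -> : uinj x.1 = x - x.2 *: 1.
  case: x ux => a k _; congr pair; first by rewrite /= scaler0 subr0.
  by rewrite /= [X in _ - X]mulr1 subrr.
apply: ubndB (ux) _; case: ux => x2 _.
have := ubndZ x.2 ubnd1; rewrite mulr1; exact: ubnd_le.
Qed.

(** Completeness of the unitization, in the form in which the square root needs
    it: steps controlled by a convergent real sequence. *)
Lemma ubnd_complete (u : nat -> unitization) (r : nat -> R) (rho : R) :
  r @ \oo --> rho -> {homo r : m n / (m <= n)%N >-> m <= n} ->
  (forall m n, (m <= n)%N -> ubnd (u n - u m) (r n - r m)) ->
  exists x, forall n, ubnd (x - u n) (rho - r n).
Proof.
move=> rrho rincr ur.
have rle n : r n <= rho.
  rewrite -(cvg_lim _ rrho)//; apply: nondecreasing_cvgn_le => //.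
  by apply/cvg_ex; exists rho.
have rN e : 0 < e -> exists N, forall n, (N <= n)%N -> rho - r n < e.
  move=> e0; have /cvgrPdist_lt/(_ e e0)[N _ hN] := rrho.
  by exists N => n /hN; apply: le_lt_trans; exact: ler_norm.
have rmn e : 0 < e -> exists N, forall m n, (N <= m)%N -> (N <= n)%N ->
    exists2 M, M < e & ubnd (u m - u n) M.
  move=> e0; have [N hN] := rN _ e0; exists N => m n Nm Nn.
  have [mn|/ltnW nm] := leqP m n.
    exists (r n - r m); last by rewrite -opprB; apply/ubndN/ur.
    by apply: le_lt_trans (hN _ Nm); rewrite lerB.
  exists (r m - r n); last exact: ur.
  by apply: le_lt_trans (hN _ Nn); rewrite lerB.
have /cauchy_cvg/cvg_ex[/= a /cvg_rnormP ua] : cauchy ((fun n => (u n).1) @ \oo).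
  apply: cauchy_rnorm => e e0; have [|N hN] := rmn (e / 2); first by rewrite divr_gt0.
  exists N => m n Nm Nn; have [M Me /ubnd_fst] := hN m n Nm Nn.
  by move=> ux; apply: le_lt_trans ux _; rewrite (splitr e) ltrD.
have /complex_cauchy_cvg/cvg_ex[/= k /cvg_rnormP uk] :
    cauchy ((fun n => (u n).2 : R[i]^o) @ \oo).
  apply: cauchy_rnorm => e e0; have [N hN] := rmn e e0.
  by exists N => m n Nm Nn; have [M Me [/le_lt_trans + _]] := hN m n Nm Nn; exact.
exists (a, k) => n; apply: ubnd_eps => e e0.
have e2 : 0 < e / 2 by rewrite divr_gt0.
have [N1 /(_ (maxn n (maxn N1 _)))h1] := ua _ e2.
have [N2 /(_ (maxn n (maxn _ N2)))h2] := uk _ e2.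
set m := maxn n (maxn N1 N2).
have {}h1 : rnorm (a - (u m).1) < e / 2.
  by apply: h1; rewrite !leq_max leqnn orbT.
have {}h2 : rnorm (k - (u m).2) < e / 2.
  by apply: h2; rewrite !leq_max leqnn !orbT.
rewrite -(subrKA (u m)) addrC.
apply: ubnd_le (ubndD (ur n m _) (ubnd_pair _)); last exact: leq_maxl.
by rewrite lerD ?lerB// (splitr e) ltW// ltrD.
Qed.

(** The root is [1 - y] for the fixed point [y = (h + y^2) / 2], found by iteration
    from 0. The same iteration with [h = 1] on real numbers, [r], increases and is
    bounded by 1; it dominates the iteration in the algebra step by step, which
    gives convergence even when [|h| = 1]. Commutation and hermitian symmetry
    hold along the iteration and pass to the limit. *)
Lemma exists_sqrt_1B h : ustar h = h -> ubnd h 1 ->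
  exists s : unitization, [/\ ustar s = s, s * s = 1 - h, ubnd (1 - s) 1 &
    forall z, GRing.comm z h -> GRing.comm z s].
Proof.
move=> hs hb.
pose half : R := 2^-1.
have half0 : (0 : R) <= half by rewrite invr_ge0.
pose r n := iter n (fun t => half * (1 + t * t)) (0 : R).
pose u n := iter n (fun y => half%:C%C *: (h + y * y)) (0 : unitization).
have r_S n : r n.+1 = half * (1 + r n * r n) by [].
have u_S n : u n.+1 = half%:C%C *: (h + u n * u n) by [].
have r01 n : 0 <= r n <= 1.
  elim: n => [|n /andP[ih0 ih1]]; first by rewrite lexx ler01.
  rewrite r_S mulr_ge0 ?addr_ge0 ?mulr_ge0//=.
  rewrite /half mulrC ler_pdivrMr// mul1r -[2]/(1 + 1) lerD2l.
  by rewrite mulr_ile1.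
have rS n : r n <= r n.+1.
  rewrite r_S /half; have := sqr_ge0 (1 - r n); lra.
have rincr : {homo r : m n / (m <= n)%N >-> m <= n} by apply/nondecreasing_seqP.
have /cvg_ex[/= rho rrho] : cvg (r @ \oo).
  apply: nondecreasing_is_cvgn => //.
  by exists 1 => _ [n _ <-]; case/andP: (r01 n).
have rho1 : rho <= 1.
  rewrite -(cvg_lim _ rrho)//; apply: limr_le; first by apply/cvg_ex; exists rho.
  by near=> n; case/andP: (r01 n).
have ur n : ubnd (u n) (r n).
  elim: n => [|n ih]; first exact: ubnd0.
  rewrite r_S u_S -[half in X in ubnd _ X]ger0_norm//.
  by apply/ubndZr/ubndD => //; exact: ubndM.
have sqrB (x y : unitization) : x * x - y * y = x * (x - y) + (x - y) * y.
  by rewrite mulrBr mulrBl addrA subrK.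
have uS n : ubnd (u n.+1 - u n) (r n.+1 - r n).
  elim: n => [|n ih].
    rewrite r_S u_S !subr0 !mulr0 !addr0 -[half in X in ubnd _ X]ger0_norm//.
    exact: ubndZr.
  rewrite u_S [X in _ - X]u_S -scalerBr.
  rewrite opprD addrACA subrr add0r sqrB.
  have := ubndZr half (ubndD (ubndM (ur n.+1) ih) (ubndM ih (ur n))).
  rewrite ger0_norm//; apply: ubnd_le.
  by rewrite (r_S n.+1) [X in _ <= _ - X]r_S; lra.
have umn m n : (m <= n)%N -> ubnd (u n - u m) (r n - r m).
  elim: n => [|n ih]; first by rewrite leqn0 => /eqP ->; rewrite !subrr; exact: ubnd0.
  rewrite leq_eqVlt => /predU1P[->|]; first by rewrite !subrr; exact: ubnd0.
  rewrite ltnS => /ih {}ih; rewrite -(subrKA (u n)) -(subrKA (r n)).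
  exact: ubndD.
have [y uy] := ubnd_complete rrho rincr umn.
have yb : ubnd y 1 by have := uy 0%N; rewrite !subr0; exact: ubnd_le.
(* An equation holds in the limit once its defect is O(rho - r n). *)
have small x M : 0 <= M -> (forall n, ubnd x (M * (rho - r n))) -> x = 0.
  move=> M0 xM; apply: ubnd_eps0 => e e0.
  have M1 : 0 < M + 1 by rewrite ltr_wpDl.
  have /cvgrPdist_lt/(_ _ (divr_gt0 e0 M1))[N _ /(_ N (leqnn _))/= hN] := rrho.
  apply: ubnd_le (xM N); have := ubnd_ge0 (uy N) => d0.
  move: hN; rewrite ger0_norm// ltr_pdivlMr// => /ltW.
  by apply: le_trans; rewrite mulrC ler_wpM2l// lerDl.
have uyS n : ubnd (y - u n.+1) (rho - r n).
  by apply: ubnd_le (uy n.+1); rewrite lerB.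
have yE : y = half%:C%C *: (h + y * y).
  apply/eqP; rewrite -subr_eq0; apply/eqP/(small _ 2) => // n.
  rewrite -(subrKA (u n.+1)) [X in _ + (X - _)]u_S -scalerBr.
  rewrite opprD [X in _ *: X]addrACA subrr add0r -[u n * u n - _]opprB sqrB.
  have un1 : ubnd (u n) 1 by apply: ubnd_le (ur n); case/andP: (r01 n).
  have := ubndZr half (ubndN (ubndD (ubndM yb (uy n)) (ubndM (uy n) un1))).
  move=> /(ubndD (uyS n)); apply: ubnd_le.
  by rewrite ger0_norm// /half; lra.
have yc z : GRing.comm z h -> GRing.comm z y.
  move=> zh; have [M M0 zM] := ubnd_ex z.
  have zu n : GRing.comm z (u n).
    elim: n => [|n ih]; first exact: commr0.
    rewrite u_S /GRing.comm -scalerAl -scalerAr; congr (_ *: _).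
    by apply: commrD => //; exact: commrM.
  apply/eqP; rewrite -subr_eq0; apply/eqP/(small _ (2 * M)).
    by rewrite mulr_ge0// ltW.
  move=> n; have -> : z * y - y * z = z * (y - u n) - (y - u n) * z.
    by rewrite mulrBr mulrBl zu opprB addrA subrK.
  apply: ubnd_le (ubndB (ubndM zM (uy n)) (ubndM (uy n) zM)).
  lra.
have ys : ustar y = y.
  have us n : ustar (u n) = u n.
    elim: n => [|n ih]; first exact: ustar0.
    by rewrite u_S ustarZr ustarD hs ustarM ih.
  apply/eqP; rewrite -subr_eq0; apply/eqP/(small _ 2) => // n.
  rewrite -(subrKA (u n)) -{1}(us n) -ustarN -ustarD -[u n - y]opprB.
  apply: ubnd_le (ubndB (ubnd_star (uy n)) (uy n)); lra.
exists (1 - y); split; first by rewrite ustarD ustarN ustar1 ys.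
- have yy : y * y = y + y - h.
    have h1 : half%:C%C + half%:C%C = 1.
      by rewrite -rmorphD/= (_ : half + half = 1)//; rewrite /half; lra.
    have -> : y + y = h + y * y by rewrite [in LHS]yE -scalerDl h1 scale1r.
    by rewrite addrAC subrr add0r.
  rewrite mulrBl mul1r mulrBr mulr1 yy opprB.
  by rewrite [X in _ + X]addrAC addrK addrA subrK.
- by rewrite opprB addrC subrK.
- by move=> z /yc; apply: commrB; exact: commr1.
Unshelve. all: by end_near.
Qed.
End Unitization.

(** * Positive elements of the unitization *)

Section Positive.
Variables (R : realType) (A : cstarAlgType R).
Local Notation U := (unitization A).
Implicit Types (x y z s : U) (t : R).

(** Equivalent to having a spectrum in the nonnegative reals, as the interval
    [[0, 2t]] is the real part of the disc of centre and radius [t]. *)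
Definition upos x : Prop :=
  ustar x = x /\ exists t, ubnd (t%:C%C%:A - x) t.

Lemma upos0 : upos 0.
Proof.
split; first exact: ustar0.
by exists 0; rewrite scale0r subr0; exact: ubnd0.
Qed.

Lemma uposD x y : upos x -> upos y -> upos (x + y).
Proof.
move=> [xs [t xt]] [ys [u yu]]; split; first by rewrite ustarD xs ys.
by exists (t + u); rewrite rmorphD/= scalerDl opprD addrACA; exact: ubndD.
Qed.

Lemma uposZ t x : 0 <= t -> upos x -> upos (t%:C%C *: x).
Proof.
move=> t0 [xs [u xu]]; split; first by rewrite ustarZr xs.
exists (t * u); rewrite rmorphM/= -scalerA -scalerBr.
by rewrite -{2}(ger0_norm t0); exact: ubndZr.
Qed.

(** If [|t - x| <= t] then [x / t = 1 - h] with [|h| <= 1]. The root [s] of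
    [1 - h] is itself positive because it comes with [|1 - s| <= 1]. *)
Lemma exists_upos_sqrt x : upos x ->
  exists s, [/\ upos s, s * s = x & forall z, GRing.comm z x -> GRing.comm z s].
Proof.
move=> [xs [t xt]]; have := ubnd_ge0 xt; rewrite le_eqVlt => /predU1P[t0|t0].
  exists 0; split; [exact: upos0| |by move=> z _; exact: commr0].
  move: xt; rewrite -t0 scale0r sub0r => /ubnd_eq0/eqP.
  by rewrite oppr_eq0 => /eqP ->; rewrite mul0r.
have tn0 : t%:C%C != 0 by rewrite gt_eqF// ltcR.
pose h : U := 1 - t^-1%:C%C *: x.
have hE : h = t^-1%:C%C *: (t%:C%C%:A - x).
  by rewrite scalerBr scalerA -rmorphM/= mulVf ?gt_eqF// scale1r.
have [||s [ss s2 s1 sc]] := @exists_sqrt_1B _ _ h.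
- by rewrite ustarD ustarN ustar1 ustarZr xs.
- rewrite hE; have := ubndZr t^-1 xt.
  by rewrite ger0_norm ?invr_ge0 ?ltW// mulVf ?gt_eqF.
exists ((Num.sqrt t)%:C%C *: s); split.
- by apply: uposZ => //; split => //; exists 1; rewrite scale1r.
- rewrite -scalerAl -scalerAr scalerA -rmorphM/= -expr2 sqr_sqrtr ?ltW// s2.
  by rewrite opprB addrC subrK scalerA -rmorphM/= divff ?gt_eqF// scale1r.
- move=> z zx; rewrite /GRing.comm -scalerAl -scalerAr; congr (_ *: _).
  apply: sc; apply: commrB; first exact: commr1.
  by rewrite /GRing.comm -scalerAl -scalerAr zx.
Qed.

(** For [v = s + i z] the hypotheses give [v^* v = t], so [v] and [v^*] have norm
    at most [sqrt t], and [s] is their half sum. *)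
Lemma ubnd_sum_sqr s z t : ustar s = s -> ustar z = z -> GRing.comm s z ->
  0 <= t -> s * s + z * z = t%:C%C%:A -> ubnd s (Num.sqrt t).
Proof.
move=> ss zs sz t0 szt.
have ii : 'i * 'i = -1 :> R[i] by rewrite -expr2 sqrCi.
pose v := s + 'i *: z.
have vs : ustar v = s - 'i *: z.
  by rewrite ustarD ustarZ ss zs conjCi scaleNr.
have vb : ubnd v (Num.sqrt t).
  apply: ubnd_star_mul; first exact: sqrtr_ge0.
  rewrite sqr_sqrtr// vs mulrBl !mulrDr -!scalerAl -!scalerAr sz scalerA.
  rewrite ii opprD addrA addrK scaleN1r opprK szt.
  have := ubndZr t (ubnd1 A).
  by rewrite ger0_norm// mulr1.
have -> : s = (2^-1)%:C%C *: (v + ustar v).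
  rewrite vs addrACA subrr addr0 scalerDr -scalerDl -rmorphD/=.
  by rewrite (_ : 2^-1 + 2^-1 = 1 :> R) ?scale1r//; lra.
have := ubndZr 2^-1 (ubndD vb (ubnd_star vb)).
by apply: ubnd_le; rewrite ger0_norm//; lra.
Qed.

(** When [|s| <= 1], let [z] be a root of [1 - s^2]. As [s^2 + z^2 = 1], also
    [|z| <= 1], hence [|1 - s^2| = |z^2| <= 1]. *)
Lemma upos_sqr s : ustar s = s -> upos (s * s).
Proof.
move=> ss; have [M M0 sM] := ubnd_ex s.
pose q := M^-1%:C%C *: s.
have qs : ustar q = q by rewrite ustarZr ss.
have q1 : ubnd q 1.
  by have := ubndZr M^-1 sM; rewrite ger0_norm ?invr_ge0 ?ltW// mulVf ?gt_eqF.
have [||z [zs z2 _ zc]] := @exists_sqrt_1B _ _ (q * q).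
- by rewrite ustarM qs.
- by have := ubndM q1 q1; rewrite mulr1.
have qz : GRing.comm q z by apply: zc; exact: commrM.
have z1 : ubnd z 1.
  rewrite -(sqrtr1 R); apply: (@ubnd_sum_sqr z q) => //.
  by rewrite z2 subrK scale1r.
have -> : s * s = (M ^+ 2)%:C%C *: (q * q).
  rewrite -scalerAl -scalerAr !scalerA -!rmorphM/=.
  by rewrite [X in X%:C%C](_ : _ = 1) ?scale1r//; field; rewrite gt_eqF.
apply: uposZ; first exact: sqr_ge0.
split; first by rewrite ustarM qs.
exists 1; rewrite scale1r -z2.
by have := ubndM z1 z1; rewrite mulr1.
Qed.

(** The roots [s] of [x] and [z] of [t - x] commute and [s^2 + z^2 = t]. *)
Lemma upos_le_ubnd x t : 0 <= t -> upos x -> upos (t%:C%C%:A - x) -> ubnd x t.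
Proof.
move=> t0 /exists_upos_sqrt[s [[ss _] s2 sc]] /exists_upos_sqrt[z [[zs _] z2 zc]].
have xz : GRing.comm x z.
  apply: zc; apply: commrB => //; rewrite /GRing.comm -scalerAl -scalerAr.
  by rewrite mulr1 mul1r.
have zs' : GRing.comm z s by apply: sc; exact: (esym xz).
have sb : ubnd s (Num.sqrt t).
  apply: (@ubnd_sum_sqr s z) => //.
  by rewrite s2 z2 addrC subrK.
by rewrite -s2; have := ubndM sb sb; rewrite -[Num.sqrt t * _]expr2 sqr_sqrtr.
Qed.

Lemma upos_subr_ubnd x t : ustar x = x -> ubnd x t -> upos (t%:C%C%:A - x).
Proof.
move=> xs xt; split; first by rewrite ustarD ustarN xs ustarZr ustar1.
by exists t; rewrite opprB addrC subrK.
Qed.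

Lemma upos_ubnd_le x y t : upos x -> upos (y - x) -> ubnd y t -> ubnd x t.
Proof.
move=> x0 yx yt; apply: upos_le_ubnd => //; first exact: ubnd_ge0 yt.
rewrite -(subrKA y); apply: uposD => //; apply: upos_subr_ubnd => //.
by rewrite -(subrK x y) ustarD (proj1 x0) (proj1 yx).
Qed.

Lemma ustar_mul_eq0 x : ustar x * x = 0 -> x = 0.
Proof.
move=> xx; apply/ubnd_eq0/ubnd_star_mul => //.
by rewrite xx expr0n; exact: ubnd0.
Qed.

(** With [x = h + i k], [h] and [k] hermitian, this sum is [2 (h^2 + k^2)]; below,
    [h] and [k] are twice these parts up to sign. *)
Lemma upos_star_mulD x : upos (ustar x * x + x * ustar x).
Proof.
pose h := x + ustar x; pose k := 'i *: (x - ustar x).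
have hs : ustar h = h by rewrite ustarD ustarK addrC.
have ks : ustar k = k.
  by rewrite ustarZ ustarD ustarN ustarK conjCi scaleNr -scalerN opprB.
have ii : 'i * 'i = -1 :> R[i] by rewrite -expr2 sqrCi.
have -> : ustar x * x + x * ustar x = (2^-1)%:C%C *: (h * h + k * k).
  rewrite -scalerAl -scalerAr scalerA ii scaleN1r.
  rewrite mulrBl !mulrBr !mulrDl !mulrDr.
  rewrite !opprB !addrA [X in _ *: X](ACl ((3*2)*(5*7)*(1*8)*(4*6))).
  rewrite /= !subrr !addr0 scalerDr -scalerDl -rmorphD/=.
  by rewrite (_ : 2^-1 + 2^-1 = 1 :> R) ?scale1r//; lra.
apply: uposZ; first by rewrite invr_ge0.
by apply: uposD; exact: upos_sqr.
Qed.

Let complete_square x (g := x - (2^-1)%:C%C%:A) :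
  (2^-1)%:C%C *: (1 - (x + x * x) + g * g) = (5 / 8)%:C%C%:A - x.
Proof.
have half2 z : (2^-1)%:C%C *: z + (2^-1)%:C%C *: z = z.
  by rewrite -scalerDl -rmorphD/= (_ : 2^-1 + 2^-1 = 1 :> R) ?scale1r//; lra.
have -> : g * g = x * x - x + (4^-1)%:C%C%:A.
  rewrite mulrBl !mulrBr -!scalerAl -!scalerAr !mul1r !mulr1 scalerA.
  rewrite -rmorphM/= opprB !addrA [LHS](ACl (1*(2*4)*3))/= -opprD half2.
  by congr (_ + _%:C%C *: _); lra.
rewrite opprD !addrA [X in _ *: X](ACl ((1*6)*(2*5)*(3*4)))/= addNr addr0.
rewrite -opprD scalerBr scalerDr [X in _ - X]scalerDr half2 scalerA -rmorphM/=.
rewrite -scalerDl -rmorphD/=.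
by rewrite [X in X%:C%C%:A - _ = _](_ : _ = 5 / 8)//; lra.
Qed.

(** Scale to [m = 1]. Then [b = y y^*] is positive, as the sum of [y^* y + y y^*]
    and [c], and [|b| <= 1], so [|1 - b| <= 1] and
    [c + c^2 = - y^* (1 - b) y] has norm at most 1. Adding [(c - 1/2)^2 >= 0] to
    [1 - c - c^2 >= 0] gives [c <= 5/8], and [|y|^2 = |c|] is at most
    [5/8 < (4/5)^2]. *)
Lemma upos_star_mul_contract y c m : upos c -> ustar y * y = - c ->
  ubnd y m -> ubnd y (4 / 5 * m).
Proof.
move=> c0 yc ym; have := ubnd_ge0 ym; rewrite le_eqVlt => /predU1P[m0|m0].
  by move: ym; rewrite -m0 mulr0.
pose q := m^-1%:C%C *: y; pose d := (m ^- 2)%:C%C *: c.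
have mN0 : m != 0 by rewrite gt_eqF.
have q1 : ubnd q 1.
  by have := ubndZr m^-1 ym; rewrite ger0_norm ?invr_ge0 ?ltW// mulVf.
have qd : ustar q * q = - d.
  rewrite ustarZr -scalerAl -scalerAr scalerA yc -scalerN -rmorphM/=.
  by congr (_%:C%C *: _); rewrite expr2 invfM.
have d0 : upos d by apply: uposZ => //; rewrite invr_ge0 sqr_ge0.
pose b := q * ustar q.
have b0 : upos b.
  have -> : b = (ustar q * q + q * ustar q) + d by rewrite qd addrAC addNr add0r.
  by apply: uposD => //; exact: upos_star_mulD.
have b1 : ubnd (1 - b) 1.
  have bs : ustar b = b by case: b0.
  have bb : ubnd b 1 by have := ubndM q1 (ubnd_star q1); rewrite mulr1.
  have := upos_subr_ubnd bs bb; rewrite scale1r => p.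
  apply: upos_le_ubnd => //.
  by rewrite scale1r opprB addrC subrK.
have dd : ubnd (d + d * d) 1.
  have -> : d + d * d = - (ustar q * (1 - b) * q).
    rewrite mulrBr mulr1 mulrBl /b -!mulrA qd !mulrA qd mulrNN opprB opprK.
    by rewrite addrC.
  by have := ubndN (ubndM (ubndM (ubnd_star q1) b1) q1); rewrite !mulr1.
have ds : ustar d = d by case: d0.
have d58 : ubnd d (5 / 8).
  apply: upos_le_ubnd => //.
  pose g := d - (2^-1)%:C%C%:A.
  have gs : ustar g = g by rewrite ustarD ustarN ds ustarZr ustar1.
  have := upos_subr_ubnd _ dd; rewrite ustarD ustarM ds => /(_ erefl).
  rewrite scale1r => /uposD/(_ (upos_sqr gs)).
  have h0 : (0 : R) <= 2^-1 by rewrite invr_ge0.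
  move=> /(uposZ h0); congr upos.
  exact: complete_square.
have : ubnd q (4 / 5).
  apply: ubnd_star_mul => //.
  by rewrite qd; apply/ubndN; apply: ubnd_le d58; rewrite expr2; lra.
move=> /(ubndZr m); rewrite ger0_norm ?ltW// scalerA -rmorphM/= divff//.
by rewrite scale1r mulrC.
Qed.

Lemma ustar_mul_neg_eq0 y c : upos c -> ustar y * y = - c -> y = 0.
Proof.
move=> c0 yc; have [M M0 yM] := ubnd_ex y.
have yn n : ubnd y (geometric M (4 / 5) n).
  elim: n => [|n ih]; first by rewrite /= expr0 mulr1.
  rewrite /= exprS mulrCA; exact: (upos_star_mul_contract c0 yc ih).
apply: ubnd_eps0 => e e0.
have /cvgrPdist_lt/(_ e e0)[N _ /(_ N (leqnn _))] :
    geometric M (4 / 5) @ \oo --> (0 : R).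
  by apply: cvg_geometric; rewrite ger0_norm; lra.
rewrite sub0r normrN => /(le_lt_trans (ler_norm _))/ltW h.
exact: ubnd_le (yn N).
Qed.

(** Let [a = x^* x], [d] the root of [a^2] and [g = d - a], twice the negative part
    of [a]. Then [a g = - d g], so [(x g)^* (x g) = - d g^2 = - (r g)^2] with
    [r] the root of [d], and [x g] vanishes by [ustar_mul_neg_eq0]. This forces
    [d g = 0], then [g^2 = (d - a) g = 0], and [a = d] is positive. *)
Theorem upos_star_mul x : upos (ustar x * x).
Proof.
set a := ustar x * x.
have a_star : ustar a = a by rewrite ustarM ustarK.
have [d [d0 d2 dc]] := exists_upos_sqrt (upos_sqr a_star).
have [r [[rs _] r2 rc]] := exists_upos_sqrt d0.
have ds : ustar d = d by case: d0.
have ad : GRing.comm a d by apply: dc; exact: commrM.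
have ar : GRing.comm a r by exact: rc.
have dr : GRing.comm d r by exact: rc.
pose g := d - a.
have gs : ustar g = g by rewrite ustarD ustarN ds a_star.
have ag : a * g = - (d * g) by rewrite !mulrBr opprB ad d2.
have rg : GRing.comm r g by apply: commrB; exact: esym.
have rgs : ustar (r * g) = r * g by rewrite ustarM rs gs rg.
have xg : x * g = 0.
  apply: (@ustar_mul_neg_eq0 _ (r * g * (r * g))); first exact: upos_sqr.
  rewrite ustarM gs -mulrA (mulrA _ x) -/a ag mulrN; congr (- _).
  by rewrite -r2 !mulrA -rg.
have rg0 : r * g = 0.
  apply: ustar_mul_eq0; rewrite rgs.
  have : ustar (x * g) * (x * g) = 0 by rewrite xg mulr0.
  rewrite ustarM gs -mulrA (mulrA _ x) -/a ag mulrN => /eqP; rewrite oppr_eq0.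
  by rewrite -r2 !mulrA -rg => /eqP.
have dg : d * g = 0 by rewrite -r2 -mulrA rg0 mulr0.
have g0 : g = 0.
  by apply: ustar_mul_eq0; rewrite gs {1}/g mulrBl ag dg oppr0 subr0.
by rewrite (_ : a = d)//; apply/esym/eqP; rewrite -subr_eq0 -/g g0.
Qed.

End Positive.

(** * Hahn-Banach theorem *)

Section HahnBanach.
Variables (R : realType) (V : lmodType R[i]).
Implicit Types (p q : V -> R) (x y : V) (t : R).

Definition sublinear p : Prop :=
  (forall x y, p (x + y) <= p x + p y) /\
  (forall t x, 0 <= t -> p (t%:C%C *: x) = t * p x).

Lemma sublinear0 p : sublinear p -> p 0 = 0.
Proof. by move=> [_ /(_ 0 0 (lexx _))]; rewrite scale0r mul0r. Qed.

Lemma sublinear_geN p x : sublinear p -> - p (- x) <= p x.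
Proof.
move=> ps; have := proj1 ps x (- x).
by rewrite subrr sublinear0//; lra.
Qed.

(** The common source of the sublinear functionals below. The infimum of a family
    with a pointwise lower bound [l] is sublinear as soon as the inequalities
    hold up to a change of index; the reverse homogeneity inequality comes
    from scaling by [1 / t], and [0 <= l 0] takes care of [t = 0]. *)
Lemma sublinear_inf (I : Type) (D : set I) (f : I -> V -> R) (l : V -> R) :
  0 <= l 0 -> (forall i x, D i -> l x <= f i x) ->
  (exists2 i, D i & f i 0 <= 0) ->
  (forall i j x y, D i -> D j -> exists2 k, D k & f k (x + y) <= f i x + f j y) ->
  (forall i t x, D i -> 0 < t ->
    exists2 j, D j & t * f j x <= f i (t%:C%C *: x)) ->
  sublinear (fun x => inf [set f i x | i in D]) /\
  forall i x, D i -> inf [set f i x | i in D] <= f i x.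
Proof.
move=> l0 lf [i0 Di0 fi0] fD fZ; set p := fun x => inf _.
have pinf x : has_inf [set f i x | i in D].
  split; first by exists (f i0 x), i0.
  by exists (l x) => _ [i Di <-]; exact: lf.
have pf i x : D i -> p x <= f i x by move=> Di; apply: (ge_inf (pinf x).2); exists i.
split=> //; split=> [x y|].
  apply/ler_addgt0Pr => e e0; have e2 : 0 < e / 2 by rewrite divr_gt0.
  have [_ [i Di <-] hi] := inf_adherent e2 (pinf x).
  have [_ [j Dj <-] hj] := inf_adherent e2 (pinf y).
  have [k Dk hk] := fD i j x y Di Dj.
  by have := pf k (x + y) Dk; rewrite -/(p x) -/(p y) in hi hj *; lra.
have half t x : 0 < t -> t * p x <= p (t%:C%C *: x).
  move=> t0; apply: lb_le_inf; first exact: (pinf _).1.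
  move=> _ [i Di <-]; have [j Dj] := fZ i t x Di t0.
  by apply: le_trans; rewrite ler_pM2l//; exact: pf.
move=> t x; rewrite le_eqVlt => /predU1P[<-|t0].
  rewrite scale0r mul0r; apply/eqP; rewrite eq_le; apply/andP; split.
    exact: le_trans (pf _ _ Di0) fi0.
  apply: lb_le_inf; first exact: (pinf _).1.
  by move=> _ [i Di <-]; exact: le_trans (lf _ _ Di).
apply/eqP; rewrite eq_le [X in _ && X]half// andbT.
rewrite -ler_pdivrMl//; have := half t^-1 (t%:C%C *: x).
rewrite invr_gt0 t0 => /(_ isT); rewrite scalerA -rmorphM/= mulVf ?gt_eqF//.
by rewrite scale1r.
Qed.

(** By Zorn's lemma: the pointwise infimum of a chain of sublinear functionals below
    [q] is finite, because each of them is at least [- q (- x)] at [x]. *)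
Lemma exists_sublinear_min q : sublinear q ->
  exists p, [/\ sublinear p, forall x, p x <= q x &
    forall p', sublinear p' -> (forall x, p' x <= p x) -> p' = p].
Proof.
move=> qs; pose T := {p : V -> R | sublinear p /\ forall x, p x <= q x}.
pose ge (p p' : T) : bool := `[< forall x, sval p' x <= sval p x >].
have [|r s t|s t|C Ctot|] := @Zorn T ge.
- by move=> p; apply/asboolP => x; exact: lexx.
- by move=> /asboolP rs /asboolP st; apply/asboolP => x; exact: le_trans (rs x).
- move=> /asboolP; case: s => s ps st /asboolP; case: t st => t pt /= st ts.
  apply: eq_exist.
  by apply/funext => x; apply/eqP; rewrite eq_le st ts.
- have [[c0 Cc0]|C0] := pselect (C !=set0); last first.
    exists (exist _ q (conj qs (fun x => lexx _))) => s Cs.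
    by exfalso; apply: C0; exists s.
  have [||||| ps pC] := @sublinear_inf T C sval (fun x => - q (- x)).
  + by rewrite oppr0 sublinear0// oppr0.
  + move=> [c [cs cq]] x _ /=; apply: le_trans (sublinear_geN x cs).
    by rewrite lerN2.
  + by exists c0 => //; case: (c0) => c [cs _] /=; rewrite sublinear0.
  + move=> c1 c2 x y C1 C2.
    have [/asboolP h|/asboolP h] := Ctot _ _ C1 C2.
      exists c2 => //; case: (c2) h => c [[cD _] _] /= h.
      by apply: le_trans (cD x y) _; rewrite lerD2r.
    exists c1 => //; case: (c1) h => c [[cD _] _] /= h.
    by apply: le_trans (cD x y) _; rewrite lerD2l.
  + move=> c t x Cc t0; exists c => //; case: (c) => c' [[_ cZ] _] /=.
    by rewrite cZ// ltW.
  have pq x : inf [set sval c x | c in C] <= q x.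
    by apply: le_trans (pC c0 x Cc0) _; case: (c0) => c [].
  pose m : T := exist _ (fun x => inf [set sval c x | c in C]) (conj ps pq).
  by exists m => s Cs; apply/asboolP => x; exact: pC.
move=> [p [ps pq]] pmin; exists p; split=> // p' ps' pp'.
have pq' x : p' x <= q x by exact: le_trans (pq x).
have := pmin (exist _ p' (conj ps' pq')).
by move=> /(_ _)/(congr1 sval); apply; apply/asboolP.
Qed.

(** The functional [p' z = inf_(t >= 0) (p (z + t y) - t p y)] is sublinear and below
    [p], hence equal to [p]; for [z = x] and [t = 1] this says
    [p x <= p (x + y) - p y]. *)
Lemma sublinear_min_additive p : sublinear p ->
  (forall p', sublinear p' -> (forall x, p' x <= p x) -> p' = p) ->
  forall x y, p (x + y) = p x + p y.
Proof.
move=> ps pmin x y; have p0 := sublinear0 ps.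
have pN z : - p (- z) <= p z := sublinear_geN z ps.
case: (ps) => pD pZ.
have [||||| p's p'le] := @sublinear_inf R [set t | 0 <= t]
    (fun t z => p (z + t%:C%C *: y) - t * p y) (fun z => - p (- z)).
- by rewrite oppr0 p0 oppr0.
- move=> t z /= t0; have := pD (z + t%:C%C *: y) (- z).
  by rewrite addrAC subrr add0r pZ//; lra.
- by exists 0 => //=; rewrite scale0r addr0 p0 mul0r subr0.
- move=> t u z w /= t0 u0; exists (t + u); first exact: addr_ge0.
  have := pD (z + t%:C%C *: y) (w + u%:C%C *: y).
  by rewrite addrACA -scalerDl -rmorphD/=; lra.
- move=> u t z /= u0 t0; exists (t^-1 * u).
    by rewrite /= mulr_ge0// invr_ge0 ltW.
  rewrite mulrBr -[t * p _]pZ ?(ltW t0)// scalerDr scalerA -rmorphM/= !mulrA.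
  by rewrite divff ?gt_eqF// mul1r.
set p' := fun z => inf _ in p's p'le.
have p'p : p' = p.
  apply: pmin => // z; have := p'le 0 z (lexx _).
  by rewrite scale0r addr0 mul0r subr0.
apply/eqP; rewrite eq_le pD/=.
have := p'le 1 x ler01; rewrite -/(p' x) p'p scale1r mul1r; lra.
Qed.

(** A real-linear [f] is the real part of the complex-linear
    [x |-> f x - i f (i x)]. *)
Theorem exists_dominated_functional q : sublinear q ->
  exists F : {scalar V}, forall x, complex.Re (F x) <= q x.
Proof.
move=> /exists_sublinear_min[f [fs fq /(sublinear_min_additive fs) fD]].
have f0 := sublinear0 fs.
have fN x : f (- x) = - f x.
  by apply/eqP; rewrite -subr_eq0 opprK -fD addNr f0.
have fZ t x : f (t%:C%C *: x) = t * f x.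
  have [t0|/ltW t0] := leP 0 t; first exact: (proj2 fs).
  have := proj2 fs (- t) x; rewrite oppr_ge0 t0 => /(_ isT).
  by rewrite rmorphN/= scaleNr fN mulNr => /oppr_inj.
pose F x : R[i] := (f x +i* - f ('i%C *: x))%C.
have fC a b x : f ((a +i* b)%C *: x) = a * f x + b * f ('i%C *: x).
  have -> : (a +i* b)%C = a%:C%C + b%:C%C * 'i%C :> R[i] by simpc.
  by rewrite scalerDl fD -scalerA !fZ.
have F_linear : scalar F.
  move=> [a b] x y; rewrite /F scalerDr scalerA !fD.
  have -> : 'i%C * (a +i* b)%C = (- b +i* a)%C :> R[i] by simpc.
  rewrite (fC a b) (fC (- b) a); simpc; apply/eqP; rewrite eq_complex/=.
  by apply/andP; split; apply/eqP; ring.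
pose F' := GRing.isLinear.Build R[i] V R[i] *%R F F_linear.
pose FL : {scalar V} := HB.pack F F'.
by exists FL.
Qed.

End HahnBanach.

(** The functional is dominated by the infimum of [|x + s k| - s d] over [s >= 0]
    and [k] in [K]: taking [s = 0] bounds it by the norm, and taking [x = - k],
    [s = 1] bounds it below by [d] on [K]. The bound [|k| >= d] keeps the
    infimum above [- |x|], and convexity of [K] makes it subadditive. *)
Theorem separation_from_ball (R : realType) (V : normedModType R[i]) (K : set V)
    (d : R) : K !=set0 ->
  (forall x y (s t : R), K x -> K y -> 0 <= s -> 0 <= t -> s + t = 1 ->
    K (s%:C%C *: x + t%:C%C *: y)) ->
  (forall x, K x -> d <= rnorm x) ->
  exists F : {scalar V}, (forall x, complex.Re (F x) <= rnorm x) /\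
    forall x, K x -> d <= complex.Re (F x).
Proof.
move=> [k0 Kk0] Kconv Kd.
have [||||| qs qle] := @sublinear_inf R V (R * V) [set z | 0 <= z.1 /\ K z.2]
    (fun z x => rnorm (x + z.1%:C%C *: z.2) - z.1 * d) (fun x => - rnorm x).
- by rewrite rnorm0 oppr0.
- move=> [s k] x [/= s0 /Kd kd]; have := ler_rnormD (x + s%:C%C *: k) (- x).
  rewrite addrAC subrr add0r rnormN rnormZr ger0_norm//.
  by have := ler_wpM2l s0 kd; lra.
- by exists (0, k0) => //=; rewrite scale0r add0r rnorm0 mul0r subr0.
- move=> [s k] [t l] x y [/= s0 Kk] [/= t0 Kl].
  have [k' Kk' k'E] : exists2 k', K k' &
      (s + t)%:C%C *: k' = s%:C%C *: k + t%:C%C *: l.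
    have [st0|st0] := eqVneq (s + t) 0.
      have -> : s = 0 by lra.
      have -> : t = 0 by lra.
      by exists k => //; rewrite addr0 !scale0r addr0.
    exists ((s / (s + t))%:C%C *: k + (t / (s + t))%:C%C *: l).
      apply: Kconv => //; rewrite ?divr_ge0 ?addr_ge0//.
      by rewrite -mulrDl divff.
    rewrite scalerDr !scalerA -!rmorphM/= !(mulrC (s + t)) !divfK//.
  exists (s + t, k'); first by split => //=; exact: addr_ge0.
  rewrite /= k'E addrACA.
  by have := ler_rnormD (x + s%:C%C *: k) (y + t%:C%C *: l); lra.
- move=> [s k] t x [/= s0 Kk] t0; exists (t^-1 * s, k).
    by split => //=; rewrite mulr_ge0// invr_ge0 ltW.
  rewrite /= mulrBr -{1}(gtr0_norm t0) -rnormZr scalerDr scalerA -rmorphM/=.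
  by rewrite !mulrA divff ?gt_eqF// mul1r.
have [F Fq] := exists_dominated_functional qs.
exists F; split=> [x|x Kx].
  apply: le_trans (Fq x) _; have := qle (0, k0) x (conj (lexx _) Kk0).
  by rewrite /= scale0r addr0 mul0r subr0.
have := le_trans (Fq (- x)) (qle (1, x) (- x) (conj ler01 Kx)).
by rewrite /= scale1r addNr rnorm0 mul1r linearN raddfN/=; lra.
Qed.

(** * Orthogonal complements in Hilbert spaces *)

Section Distance.
Variables (R : realType) (V : normedModType R[i]) (S : set V) (z : V) (d : R).
Hypotheses (d0 : 0 < d) (Sd : forall x, S x -> d <= rnorm (z - x)).

Lemma far_not_closure : ~ closure S z.
Proof.
move=> /(_ (ball z d%:C%C))[].
  by apply: nbhsx_ballx; rewrite ltcR.
move=> x [/Sd + ]; rewrite -ball_normE/= -rnormE ltcR => /le_lt_trans h /h.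
by rewrite ltxx.
Qed.

Lemma far_not_dense : ~ dense S.
Proof.
have dC : 0 < d%:C%C by rewrite ltcR.
move=> /(_ (ball z d%:C%C))[]; first by exists z; exact: ballxx.
  exact: ball_open.
move=> x [+ /Sd]; rewrite -ball_normE/= -rnormE ltcR => + /le_lt_trans h => /h.
by rewrite ltxx.
Qed.

End Distance.

Section Orthocomplement.
Variables (R : realType) (H : hilbertType R).
Implicit Types x y v : H.

Lemma rnorm_sqr x : (rnorm x ^+ 2)%:C%C = dot x x.
Proof. by rewrite rmorphXn/= rnormE dot_norm. Qed.

Lemma rnorm_sqrD x y :
  rnorm (x + y) ^+ 2 = rnorm x ^+ 2 + rnorm y ^+ 2 + 2 * complex.Re (dot x y).
Proof.
have sqrE (u : H) : rnorm u ^+ 2 = complex.Re (dot u u).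
  by have /(congr1 (@complex.Re R)) := rnorm_sqr u.
have ReC : complex.Re (dot y x) = complex.Re (dot x y).
  by rewrite -dotC; case: (dot x y).
rewrite !sqrE -[dot]/(sform (dot_semiInner H)) sformDr !sformDl.
by rewrite !raddfD/= ReC; ring.
Qed.

Lemma parallelogram x y :
  rnorm (x + y) ^+ 2 + rnorm (x - y) ^+ 2 = 2 * rnorm x ^+ 2 + 2 * rnorm y ^+ 2.
Proof.
rewrite !rnorm_sqrD rnormN -[dot]/(sform (dot_semiInner H)) sformNr raddfN/=.
by ring.
Qed.

(** For [c = <s, v>] and [k = - e c] one has
    [|v + k s|^2 = |v|^2 - |c|^2 e (2 - e |s|^2)], which is smaller than [|v|^2]
    for [e = 1 / (|s|^2 + 1)] unless [c = 0]. *)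
Lemma minimal_norm_orthogonal v (s : H) :
  (forall k : R[i], rnorm v <= rnorm (v + k *: s)) -> dot s v = 0.
Proof.
move=> vmin; set c := dot s v; pose e := (rnorm s ^+ 2 + 1)^-1.
have s1 : 0 < rnorm s ^+ 2 + 1 by rewrite ltr_wpDl// sqr_ge0.
have e0 : 0 < e by rewrite invr_gt0.
have es : e * (rnorm s ^+ 2 + 1) = 1 by rewrite mulVf// gt_eqF.
pose m := complex.Re `|c|.
have mE : m%:C%C = `|c| by rewrite Re_realC// normr_real.
have /= := vmin (- (e%:C%C * c)).
rewrite -(@ler_pXn2r _ 2)// ?nnegrE ?rnorm_ge0// rnorm_sqrD dotZr -dotC -/c.
have -> : complex.Re (- (e%:C%C * c) * c^*) = - (e * m ^+ 2).
  by rewrite mulNr -mulrA -normCK -mE -rmorphXn -rmorphM raddfN.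
rewrite rnormZ normrN normrM -mE.
have -> : complex.Re (`|e%:C%C| * m%:C%C) = e * m.
  by rewrite ger0_norm ?lecR ?ltW// ReM_real.
rewrite -addrA lerDl exprMn => h.
have h2 : e * m ^+ 2 * (e * rnorm s ^+ 2 - 2) = e * m ^+ 2 * (- 1 - e).
  by congr (_ * _); lra.
have /eqP m0 : m ^+ 2 == 0.
  apply: contraTT (h) => m2; rewrite -ltNge.
  have em : 0 < e * m ^+ 2 by rewrite mulr_gt0// lt_def m2 sqr_ge0.
  nra.
by apply/normr0_eq0; rewrite -mE; move/eqP: m0; rewrite expf_eq0/= => /eqP ->.
Qed.

(** The parallelogram identity makes minimising sequences Cauchy. Their
    limit lies in the closure of [S] only, so minimality is stated through the
    translates of the limit by elements of [S]. *)
Lemma closest_point (S : set H) z : S 0 -> (forall x y, S x -> S y -> S (x + y)) ->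
  (forall (k : R[i]) x, S x -> S (k *: x)) ->
  exists2 x, closure S x & forall y, S y -> rnorm (z - x) <= rnorm (z - x + y).
Proof.
move=> S0 SD SZ.
pose D := [set rnorm (z - x) | x in S]; pose d := inf D.
have Dinf : has_inf D.
  by split; [exists (rnorm (z - 0)), 0|exists 0 => _ [x _ <-]; exact: rnorm_ge0].
have dle x : S x -> d <= rnorm (z - x).
  by move=> Sx; apply: (ge_inf Dinf.2); exists x.
have d0 : 0 <= d.
  by apply: lb_le_inf; [exact: Dinf.1|move=> _ [x _ <-]; exact: rnorm_ge0].
have /choice[u hu] n : exists x, S x /\ rnorm (z - x) ^+ 2 < d ^+ 2 + n.+1%:R^-1.
  have n0 : 0 < n.+1%:R^-1 :> R by rewrite invr_gt0 ltr0n.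
  have dn : 0 < Num.sqrt (d ^+ 2 + n.+1%:R^-1) - d.
    rewrite subr_gt0 -{1}(ger0_norm d0) -sqrtr_sqr ltr_sqrt ?ltrDl//.
    by rewrite ltr_wpDl// sqr_ge0.
  have [_ [x Sx <-]] := inf_adherent dn Dinf; rewrite -/d subrKC => h.
  exists x; split => //.
  rewrite -[ltRHS]sqr_sqrtr.
    by rewrite ltr_pXn2r// ?nnegrE ?sqrtr_ge0 ?rnorm_ge0.
  by rewrite addr_ge0 ?sqr_ge0// ltW.
have small e : 0 < e -> exists N, forall n, (N <= n)%N ->
    rnorm (z - u n) ^+ 2 < d ^+ 2 + e.
  move=> e0; have [N _ hN] := near_infty_natSinv_lt (PosNum e0).
  exists N => n /hN/= ne; apply: lt_trans (hu n).2 _.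
  by rewrite ltrD2l.
have /cauchy_cvg/cvg_ex[/= x ux] : cauchy (u @ \oo).
  apply: cauchy_rnorm => e e0.
  have [|N hN] := small (e ^+ 2 / 4); first by rewrite divr_gt0// exprn_gt0.
  exists N => m n /hN hm /hN hn.
  rewrite -(@ltr_pXn2r _ 2)// ?nnegrE ?rnorm_ge0 ?ltW//.
  have := parallelogram (z - u m) (z - u n).
  have -> : z - u m - (z - u n) = u n - u m.
    by rewrite opprB addrC addrA subrK.
  have -> : z - u m + (z - u n) = 2%:C%C *: (z - (2^-1)%:C%C *: (u m + u n)).
    rewrite scalerBr scalerA -rmorphM/= divff// scale1r opprD addrACA.
    rewrite -opprD; congr (_ - _).
    have -> : 2%:C%C = 1 + 1 :> R[i].
      by rewrite -(rmorph1 (real_complex R)) -rmorphD.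
    by rewrite scalerDl scale1r.
  rewrite rnormZr ger0_norm// exprMn rnormB.
  have := dle _ (SZ (2^-1)%:C%C _ (SD _ _ (hu m).1 (hu n).1)).
  rewrite -(@ler_pXn2r _ 2)// ?nnegrE ?rnorm_ge0//.
  lra.
exists x => [B /ux[N _ /(_ N (leqnn N)) BN]|y Sy].
  by exists (u N); split=> //; exact: (hu N).1.
move/cvg_rnormP : ux => ux; apply: (@le_trans _ _ d).
  apply/ler_addgt0Pr => e e0.
  have e2 : 0 < e / 2 by rewrite divr_gt0.
  have [|N1 /(_ (maxn N1 _)) h1] := small ((e / 2) ^+ 2); first by rewrite exprn_gt0.
  have [N2 /(_ (maxn _ N2)) h2] := ux _ e2.
  have {}h1 := h1 N2 (leq_maxl _ _); have {}h2 := h2 N1 (leq_maxr _ _).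
  have {}h1 : rnorm (z - u (maxn N1 N2)) < d + e / 2.
    rewrite -(@ltr_pXn2r _ 2)// ?nnegrE ?rnorm_ge0 ?addr_ge0// ?ltW//.
    by apply: lt_le_trans h1 _; nra.
  have := ler_rnormD (z - u (maxn N1 N2)) (u (maxn N1 N2) - x).
  by rewrite addrA subrK; rewrite rnormB in h2; lra.
apply/ler_addgt0Pr => e e0; have [N /(_ N (leqnn _)) hN] := ux _ e0.
have SuN : S (u N - y) by rewrite -scaleN1r; apply: SD; [exact: (hu N).1|exact: SZ].
apply: le_trans (dle _ SuN) _.
have -> : z - (u N - y) = (z - x + y) + (x - u N).
  by rewrite opprB !addrA [RHS](ACl (1*3*5*(2*4)))/= addNr addr0.
by apply: le_trans (ler_rnormD _ _) _; rewrite lerD2l ltW.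
Qed.

Theorem orthocompl_neq0 (S : set H) z d : S 0 ->
  (forall x y, S x -> S y -> S (x + y)) ->
  (forall (k : R[i]) x, S x -> S (k *: x)) ->
  0 < d -> (forall x, S x -> d <= rnorm (z - x)) ->
  orthocompl S <> [set 0].
Proof.
move=> S0 SD SZ d0 Sd SE; have [x Sx hx] := closest_point z S0 SD SZ.
have : orthocompl S (z - x).
  by move=> y Sy; apply: minimal_norm_orthogonal => k; apply: hx; exact: SZ.
rewrite SE => /eqP; rewrite subr_eq0 => /eqP zx.
by apply: (far_not_closure d0 Sd); rewrite zx.
Qed.
End Orthocomplement.

(** * States *)

Section States.
Variables (R : realType) (A : cstarAlgType R).
Implicit Types a b : A.

Lemma cpositive_upos a : cpositive a -> upos (uinj a).
Proof. by move=> [b ->]; rewrite uinjM -ustar_inj; exact: upos_star_mul. Qed.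

Lemma upos_inj_star a : upos (uinj a) -> cstar a = a.
Proof. by move=> [/(congr1 fst)]. Qed.

Lemma ler_rnorm_upos a b : upos (uinj a) -> upos (uinj (b - a)) ->
  rnorm a <= rnorm b.
Proof.
move=> a0 ba; apply: rnorm_le_ubnd; apply: upos_ubnd_le a0 _ (ubnd_inj b).
by rewrite -(subrK a b) uinjD addrK.
Qed.

(** Multiply [x] by a unimodular scalar that makes [F x] real. *)
Lemma dominated_norm (V : normedModType R[i]) (F : {scalar V}) :
  (forall x, complex.Re (F x) <= rnorm x) ->
  forall x, complex.Re `|F x| <= rnorm x.
Proof.
move=> Fle x; have [->|F0] := eqVneq (F x) 0; first by rewrite normr0 rnorm_ge0.
pose k := (F x)^* / `|F x|.
have k1 : `|k| = 1 by rewrite normf_div norm_conjC normr_id divff// normr_eq0.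
have kF : k * F x = `|F x|.
  by rewrite mulrAC [_^* * _]mulrC -normCK expr2 mulfK// normr_eq0.
by have := Fle (k *: x); rewrite linearZ/= kF rnormZ k1 mul1r.
Qed.

(** The state is [G / |G|], where [G a] is the mean of [F a] and of the conjugate of
    the value of [F] at the adjoint of [a]. This hermitian part of [F] takes the
    value [Re (F a)] at hermitian [a], and [p] ensures that it is not zero. *)
Lemma state_of_functional (F : {scalar A}) (p : A) :
  (forall a, complex.Re (F a) <= rnorm a) ->
  (forall a, upos (uinj a) -> 0 <= complex.Re (F a)) ->
  cpositive p -> 0 < complex.Re (F p) ->
  exists w : state A, exists2 c, 0 < c &
    forall a, cpositive a -> w a = (c * complex.Re (F a))%:C%C.
Proof.
move=> Fle F0 pp Fp.
pose G a : R[i] := (2^-1)%:C%C * (F a + (F (cstar a))^*).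
have G_linear : scalar G.
  move=> k a b; rewrite /G cstarD cstarZ !linearP/= rmorphD rmorphM/= conjCK.
  by rewrite mulrCA -mulrDr; congr (_ * _); ring.
have GE a : cpositive a -> G a = (complex.Re (F a))%:C%C.
  move=> /cpositive_upos/upos_inj_star aa; rewrite /G aa.
  case: (F a) => x y; apply/eqP; rewrite eq_complex/=.
  by apply/andP; split; apply/eqP; lra.
have Gle a : complex.Re `|G a| <= rnorm a.
  have Fn := dominated_norm Fle.
  rewrite -lecR Re_realC ?normr_real// normrM.
  have h2 : 0 <= (2^-1)%:C%C :> R[i] by rewrite lecR invr_ge0.
  rewrite (ger0_norm h2).
  apply: (@le_trans _ _ ((2^-1)%:C%C * (rnorm a + rnorm a)%:C%C)).
    rewrite ler_wpM2l//; apply: le_trans (ler_normD _ _) _.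
    rewrite norm_conjC rmorphD/= lerD// -[X in X <= _]Re_realC ?normr_real// lecR.
      exact: Fn.
    by rewrite -(rnorm_cstar a); exact: Fn.
  by rewrite -rmorphM/= lecR; lra.
pose B := [set complex.Re `|G a| | a in [set a : A | `|a| <= 1]].
have ball1 a : `|a| <= 1 -> rnorm a <= 1 by rewrite -rnormE -(lecR (rnorm a)).
have Bsup : has_sup B.
  split; first by exists (complex.Re `|G 0|), 0 => //=; rewrite normr0 ler01.
  by exists 1 => _ [a /= /ball1 a1 <-]; apply: le_trans (Gle a) _.
pose n := sup B.
have GB a : `|a| <= 1 -> complex.Re `|G a| <= n.
  by move=> a1; apply: (ub_le_sup Bsup.2); exists a.
have n0 : 0 < n.
  have p0 : 0 < rnorm p by exact: lt_le_trans Fp (Fle p).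
  have q1 : `|((rnorm p)^-1)%:C%C *: p| <= 1.
    rewrite -rnormE (lecR _ 1) rnormZr ger0_norm ?invr_ge0 ?(ltW p0)//.
    by rewrite mulVf ?gt_eqF.
  apply: lt_le_trans (GB _ q1).
  have -> : G (((rnorm p)^-1)%:C%C *: p) = ((rnorm p)^-1 * complex.Re (F p))%:C%C.
    rewrite -[_ *: _]addr0 G_linear GE// /G cstar0 raddf0 rmorph0 addr0.
    by rewrite mulr0 addr0 rmorphM.
  by rewrite ger0_norm ?lecR/= ?mulr_gt0 ?invr_gt0// mulr_ge0// ltW// invr_gt0.
pose W a : R[i] := n^-1%:C%C * G a.
have W_linear : scalar W.
  by move=> k a b; rewrite /W G_linear mulrDr mulrCA.
pose WL : {scalar A} := HB.pack W (GRing.isLinear.Build R[i] A R[i] *%R W W_linear).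
have WLE a : WL a = n^-1%:C%C * G a by [].
have WE a : cpositive a -> WL a = (n^-1 * complex.Re (F a))%:C%C.
  by move=> a0; rewrite WLE GE// rmorphM.
have W0 a : cpositive a -> 0 <= WL a.
  move=> a0; rewrite WE// lecR mulr_ge0 ?invr_ge0 ?(ltW n0)//.
  exact/F0/cpositive_upos.
have Wn a : complex.Re `|WL a| = n^-1 * complex.Re `|G a|.
  by rewrite WLE normrM ger0_norm ?ReM_real// lecR invr_ge0 ltW.
have W1 : sup [set complex.Re `|WL a| | a in [set a : A | `|a| <= 1]] = 1.
  set S := [set _ | _ in _].
  have S1 : ubound S 1.
    move=> _ [a a1 <-]; rewrite Wn mulrC ler_pdivrMr// mul1r; exact: GB.
  have S0 : S !=set0.
    by exists (complex.Re `|WL 0|), 0 => //=; rewrite normr0 ler01.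
  apply/eqP; rewrite eq_le ge_sup//=.
  rewrite -(ler_pM2l n0) mulr1; apply: ge_sup; first exact: Bsup.1.
  move=> _ [a a1 <-]; rewrite -ler_pdivrMl// -Wn.
  by apply: ub_le_sup; [exists 1|exists a].
by exists (State W0 W1), n^-1; rewrite ?invr_gt0.
Qed.

End States.

(** * Separation of a point from a convex set by a state *)

Section Separation.
Variables (R : realType) (A : cstarAlgType R) (E : hilbertCModType A).
Implicit Types (x y u v : E) (L : set E).

Lemma innerDl x y z : inner (x + y) z = inner x z + inner y z :> A.
Proof. by rewrite -inner_star innerDr cstarD !inner_star. Qed.

Lemma innerZrl (t : R) x y : inner (t%:C%C *: x) y = t%:C%C *: inner x y :> A.
Proof.
rewrite -inner_star innerZr cstarZ inner_star; congr (_ *: _).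
by apply/CrealP; rewrite complex_real.
Qed.

Lemma rnorm_inner x : rnorm (inner x x : A) = rnorm x ^+ 2.
Proof.
apply: (@complexI R); rewrite rmorphXn/= !rnormE norm_inner sqrtCK//.
Qed.

(** The defect in the convexity of [x |-> <x, x>] is again of the form
    [<z, z>] up to a nonnegative factor, so that map is convex for the order
    of [A]. *)
Lemma inner_convex_comb u v (s t : R) : s + t = 1 ->
  inner (s%:C%C *: u + t%:C%C *: v) (s%:C%C *: u + t%:C%C *: v) +
    (s * t)%:C%C *: inner (u - v) (u - v) =
  s%:C%C *: inner u u + t%:C%C *: inner v v :> A.
Proof.
move=> st.
have -> : u - v = 1%:C%C *: u + (-1)%:C%C *: v.
  by rewrite rmorphN !rmorph1 scale1r scaleN1r.
rewrite !innerDl !innerDr !innerZrl !innerZr !scalerDr !scalerA -!rmorphM/=.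
rewrite !addrA [LHS](ACl ((1*5)*(4*8)*(2*6)*(3*7)))/= -!scalerDl -!rmorphD/=.
have tE : t = 1 - s by rewrite -st addrAC subrr add0r.
have -> : s * s + s * t * 1 * 1 = s by rewrite tE; ring.
have -> : t * t + s * t * -1 * -1 = t by rewrite tE; ring.
have -> : s * t + s * t * 1 * -1 = 0 by ring.
have -> : t * s + s * t * -1 * 1 = 0 by ring.
by rewrite !scale0r !addr0.
Qed.

Lemma convex_setR L : convex_set (L : set (convex_lmodType E)) ->
  forall x y (s t : R), L x -> L y -> 0 <= s -> 0 <= t -> s + t = 1 ->
  L (s%:C%C *: x + t%:C%C *: y).
Proof.
move=> cL x y s t Lx Ly s0 t0 st.
have s0' : 0 <= s%:C%C :> R[i] by rewrite lecR.
have s1' : s%:C%C <= 1 :> R[i] by rewrite (lecR _ 1) -st lerDl.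
have := cL x y (Itv01 s0' s1') (mem_set Lx) (mem_set Ly); rewrite inE.
rewrite /conv/=; congr L; congr (_ + _ *: _).
rewrite [LHS](_ : _ = 1 - s%:C%C)//.
by rewrite -(rmorph1 (real_complex R)) -rmorphB -st addrAC subrr add0r.
Qed.

Lemma closed_far L x0 : closed L -> ~ L x0 ->
  exists2 d : R, 0 < d & forall y, L y -> d <= rnorm (x0 - y).
Proof.
move=> cL Lx0; have : nbhs x0 (~` L).
  by apply: open_nbhs_nbhs; split => //; exact: closed_openC.
move=> /nbhs_normP[e /= /gt0_realC[e0 <-] he]; exists (complex.Re e) => // y Ly.
rewrite leNgt; apply/negP => ey.
by apply: (he y) => //=; rewrite -rnormE ltcR.
Qed.

(** Separates from a ball the set [K] of the elements of [A] that dominate some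
    [<y - x0, y - x0>] with [y] in [L]; being closed under adding positive
    elements, [K] forces the separating functional to be positive. *)
Theorem state_far L x0 : L !=set0 -> closed L ->
  convex_set (L : set (convex_lmodType E)) -> ~ L x0 ->
  exists w : state A, exists2 d : R, 0 < d &
    forall y, L y -> d <= rnorm (loc_map w x0 - loc_map w y).
Proof.
move=> [y0 Ly0] cL /convex_setR Lc /(closed_far cL)[d d0 Ld].
pose gap y : A := inner (y - x0) (y - x0).
have gap_pos y : upos (uinj (gap y)) by apply/cpositive_upos/inner_ge0.
have gap_norm y : L y -> d ^+ 2 <= rnorm (gap y).
  move=> Ly; rewrite rnorm_inner rnormB ler_pXn2r// ?nnegrE ?rnorm_ge0 ?(ltW d0)//.
  exact: Ld.
have uinjB (a b : A) : uinj (a - b) = uinj a - uinj b.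
  by apply/eqP; rewrite eq_sym subr_eq -uinjD subrK.
pose K := [set k : A | exists2 y, L y & upos (uinj (k - gap y))].
have Kgap y : L y -> K (gap y).
  by move=> Ly; exists y => //; rewrite subrr; exact: upos0.
have [||k Kk|F [Fle FK]] := @separation_from_ball R A K (d ^+ 2).
- by exists (gap y0); exact: Kgap.
- move=> k l s t [y Ly ky] [z Lz lz] s0 t0 st.
  exists (s%:C%C *: y + t%:C%C *: z); first exact: Lc.
  have -> : s%:C%C *: k + t%:C%C *: l - gap (s%:C%C *: y + t%:C%C *: z) =
      s%:C%C *: (k - gap y) + t%:C%C *: (l - gap z) +
      (s * t)%:C%C *: inner (y - z) (y - z).
    have := inner_convex_comb (y - x0) (z - x0) st.
    have -> : s%:C%C *: (y - x0) + t%:C%C *: (z - x0) =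
        s%:C%C *: y + t%:C%C *: z - x0.
      by rewrite !scalerBr addrACA -opprD -scalerDl -rmorphD st scale1r.
    rewrite opprB addrA subrK -/(gap y) -/(gap z) -/(gap (_ + _)) => h.
    apply: (addIr (gap (s%:C%C *: y + t%:C%C *: z))); rewrite subrK.
    rewrite -[RHS]addrA [X in _ = _ + X]addrC h !scalerBr.
    by rewrite [X in _ = X + _]addrACA -opprD subrK.
  rewrite !uinjD !uinjZ; apply: uposD; last first.
    apply: uposZ; first exact: mulr_ge0.
    exact/cpositive_upos/inner_ge0.
  by apply: uposD; exact: uposZ.
- move: Kk => [y Ly ky]; apply: le_trans (gap_norm y Ly) _.
  exact: ler_rnorm_upos.
have F0 a : upos (uinj a) -> 0 <= complex.Re (F a).
  move=> a0; rewrite leNgt; apply/negP => Fa.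
  pose g := complex.Re (F (gap y0)).
  have g0 : 0 < g by apply: lt_le_trans (FK _ (Kgap _ Ly0)); rewrite exprn_gt0.
  (* At this t the real part of F vanishes on an element of K. *)
  pose t := g / - complex.Re (F a).
  have t0 : 0 <= t by rewrite divr_ge0 ?oppr_ge0 ?(ltW g0) ?(ltW Fa).
  have : K (gap y0 + t%:C%C *: a).
    by exists y0 => //; rewrite addrAC subrr add0r uinjZ; exact: uposZ.
  move=> /FK; have -> : F (gap y0 + t%:C%C *: a) = F (gap y0) + t%:C%C * F a.
    by rewrite linearD linearZ.
  rewrite raddfD/= ReM_real -/g.
  rewrite /t invrN mulrN mulNr divfK ?lt_eqF// subrr.
  by rewrite leNgt exprn_gt0.
have [||w [c c0 wE]] := @state_of_functional R A F (gap y0) Fle F0.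
- exact: inner_ge0.
- by apply: lt_le_trans (FK _ (Kgap _ Ly0)); rewrite exprn_gt0.
have cd0 : 0 < c * d ^+ 2 by rewrite mulr_gt0// exprn_gt0.
exists w, (Num.sqrt (c * d ^+ 2)); first by rewrite sqrtr_gt0.
move=> y Ly; rewrite rnormB -linearB/=.
rewrite -(@ler_pXn2r _ 2)// ?nnegrE ?rnorm_ge0 ?sqrtr_ge0// sqr_sqrtr ?(ltW cd0)//.
rewrite -lecR rnorm_sqr dot_loc_map wE; last exact: inner_ge0.
by rewrite lecR ler_pM2l//; exact/FK/Kgap.
Qed.

End Separation.

Unset Implicit Arguments.

Theorem theorem1p2 (R : realType) (A : cstarAlgType R) (E : hilbertCModType A)
    (L : set E) (L_neq0 : L !=set0) (L_closed : closed L)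
    (L_convex : convex_set (L : set (convex_lmodType E))) :
  (forall x0 : E, ~ L x0 ->
     exists w : state A, ~ closure (loc_map w @` L) (loc_map w x0)) /\
  (L <> setT ->
     exists w : state A,
       ~ dense (loc_map w @` L) /\
       (submodule L ->
        orthocompl (loc_map w @` L) <> [set (0 : localization E w)])).
Proof.
have far x0 : ~ L x0 -> exists w : state A, exists2 d : R, 0 < d &
    forall z, (loc_map w @` L) z -> d <= rnorm (loc_map w x0 - z).
  move=> Lx0; have [w [d d0 wd]] := state_far L_neq0 L_closed L_convex Lx0.
  by exists w, d => // _ [y Ly <-]; exact: wd.
split=> [x0 /far[w [d d0 wd]]|LT].
  by exists w; exact: far_not_closure wd.
have [x0 /far[w [d d0 wd]]] : exists x0, ~ L x0.
  by apply/existsNP => LE; apply: LT; apply/seteqP; split.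
exists w; split; first exact: far_not_dense wd.
move=> [L0 LD LZ _]; apply: (orthocompl_neq0 _ _ _ d0 wd).
- by exists 0; rewrite ?linear0.
- by move=> _ _ [x Lx <-] [y Ly <-]; exists (x + y); rewrite ?linearD//; exact: LD.
- by move=> k _ [x Lx <-]; exists (k *: x); rewrite ?linearZ//; exact: LZ.
Qed.
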